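(* Let $s$ be a positive integer, $q:=2^s$, $M:=\frac{2^{3s}-1}{2^s-1}$, $G:=\mathbb{F}_{2^{6s}}$, $H:=\mathbb{F}_{2^{9s}}$, and let $T_1,T_2,T_3$ be the partition of $\mathbb{Z}_M$ and $C_i^{(M,G)}$, $C_i^{(M,H)}$ $(i\in\mathbb{Z}_M)$ the cyclotomic classes of order $M$ of $G$ and $H$ defined in the context. (i) Put $$R_0'=\{0\},\quad R_1'=\bigcup_{i\in T_1} C_i^{(M,G)},\quad R_2'=\bigcup_{i\in T_2} C_i^{(M,G)},\quad R_3'=\bigcup_{i\in T_3} C_i^{(M,G)}.$$ Then $(G,\{R_i'\}_{i=0}^{3})$ is a three-class association scheme. Its parameters are as follows: the intersection matrices $B_i$ $(i=1,2,3)$, whose $(k,j)$ entry is $p_{i,j}^k$ $(0\le k,j\le 3)$, are $$B_1=\begin{pmatrix} 0&q^5+q^2-q^3-1&0&0\\ 1&-q^3+q^2+q^4-2&\frac12 q^3 (q^2-1)&\frac12 (q^2-2 q+1) q^3\\ 0&(q-1) q^2 (q+1)&\frac12 (q-1) (q^4+q^3-q^2+q+2)&\frac12 (q-1) q (q^3-q^2-q+1)\\ 0&(q-1) q^2 (q+1)&\frac12 q (q^3-q^2-q+1) (q+1)&\frac12 (q^4-2-3 q^3+3 q^2+q) (q+1) \end{pmatrix},$$ $$B_2=\begin{pmatrix} 0&0&\frac{1}{2} q^6-\frac{1}{2} q^4+\frac{1}{2} q^3-\frac{1}{2} q&0\\ 0&\frac{1}{2} q^3 (q^2-1)&\frac{1}{4}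 (q^5-2 q^3+2 q^2+q-2) q&\frac{1}{4} (-1+q^4+2 q-2 q^3) q^2\\ 1&\frac{1}{2} (q-1) (q^4+q^3-q^2+q+2)&\frac{1}{4} (q^5-3 q^3+3 q^2+q-6) q&\frac{1}{4} q (q^4-2-q^3+3 q) (q-1)\\ 0&\frac{1}{2} q (q^3-q^2-q+1) (q+1)&\frac{1}{4} q (q^4-2-q^3+3 q) (q+1)&\frac{1}{4} q (q^4-2-3 q^3+2 q^2+q) (q+1) \end{pmatrix},$$ $$B_3=\begin{pmatrix} 0&0&0&-q^2+\frac{1}{2} q^3-q^5+\frac{1}{2} q+\frac{1}{2} q^4+\frac{1}{2} q^6\\ 0&\frac{1}{2} (q^2-2 q+1) q^3&\frac{1}{4} (-1+q^4+2 q-2 q^3) q^2&\frac{1}{4} (q^5-4 q^4+6 q^3-2 q^2-3 q+2) q\\ 0&\frac{1}{2} (q-1) q (q^3-q^2-q+1)&\frac{1}{4} q (q^4-2-q^3+3 q) (q-1)&\frac{1}{4} q (q^4-2-3 q^3+2 q^2+q) (q-1)\\ 1&\frac{1}{2} (q^4-2-3 q^3+3 q^2+q) (q+1)&\frac{1}{4} q (q^4-2-3 q^3+2 q^2+q) (q+1)&\frac{1}{4} q (q^5+6+7 q^3-q^2-4 q^4-11 q) \end{pmatrix}.$$ (ii) Put $$R_0''=\{0\},\quad R_1''=\bigcup_{i\in T_1} C_i^{(M,H)},\quad R_2''=\bigcup_{i\in T_2} C_i^{(M,H)},\quad R_3''=\bigcup_{i\in T_3} C_i^{(M,H)}.$$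 Then $(H,\{R_i''\}_{i=0}^{3})$ is a three-class association scheme. Its parameters are as follows: the intersection matrices $B_i=(p_{i,j}^k)_{0\le k,j\le 3}$ (row index $k$, column index $j$) of this scheme have the following entries. The matrix $B_1$ has rows (for $k=0,1,2,3$) $$\left(0,\; q^8+q^5+q^2-q^6-q^3-1,\; 0,\; 0\right),$$ $$\left(1,\; q^7-2 q^5+2 q^4-q^3+q^2-2,\; \tfrac{1}{2} (q^5-2 q^3+2 q^2-1) q^3,\; \tfrac{1}{2} (q^5-2 q^4+4 q^2-4 q+1) q^3\right),$$ $$\left(0,\; (q^5-2 q^3+2 q^2-1) q^2,\; \tfrac{1}{2} q^8-q^6+q^5+\tfrac{1}{2} q^4-\tfrac{3}{2} q^3+q^2+\tfrac{1}{2} q-1,\; \tfrac{1}{2} (q^7-2 q^6+4 q^4-5 q^3+q^2+2 q-1) q\right),$$ $$\left(0,\; (q^5-2 q^3+2 q^2+2 q-1) q^2,\; \tfrac{1}{2} (q^7-2 q^5+2 q^4+q^3-3 q^2+1) q,\; \tfrac{1}{2} q^8-q^7+2 q^5-\tfrac{5}{2} q^4-\tfrac{3}{2} q^3+2 q^2-\tfrac{1}{2} q-1\right).$$ The matrix $B_2$ has rows (for $k=0,1,2,3$) $$\left(0,\; 0,\; -\tfrac{1}{2} q-\tfrac{1}{2} q^4+\tfrac{1}{2} q^3+\tfrac{1}{2} q^6-\tfrac{1}{2} q^7+\tfrac{1}{2} q^9,\; 0\right),$$ $$\left(0,\; \tfrac{1}{2} (q^5-2 q^3+2 q^2-1) q^3,\;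 \tfrac{1}{4} (q^8-2 q^6+2 q^5+q^4-3 q^3+2 q^2+q-2) q,\; \tfrac{1}{4} (q^7-2 q^6+4 q^4-5 q^3+q^2+2 q-1) q^2\right),$$ $$\left(1,\; \tfrac{1}{2} q^8-q^6+q^5+\tfrac{1}{2} q^4-\tfrac{3}{2} q^3+q^2+\tfrac{1}{2} q-1,\; \tfrac{1}{4} (q^8-2 q^6+2 q^5+2 q^4-7 q^3+5 q^2+q-6) q,\; \tfrac{1}{4} (q^8-2 q^7+4 q^5-6 q^4+3 q^3+3 q^2-5 q+2) q\right),$$ $$\left(0,\; \tfrac{1}{2} (q^7-2 q^5+2 q^4+q^3-3 q^2+1) q,\; \tfrac{1}{4} (q^8-2 q^6+2 q^5-3 q^3+3 q^2+q-2) q,\; \tfrac{1}{4} (q^8-2 q^7+4 q^5-4 q^4-q^3+5 q^2-q-2) q\right).$$ The matrix $B_3$ has rows (for $k=0,1,2,3$) $$\left(0,\; 0,\; 0,\; \tfrac{1}{2} q-q^2+\tfrac{1}{2} q^4+\tfrac{1}{2} q^3-q^5+\tfrac{1}{2} q^6-q^8+\tfrac{1}{2} q^7+\tfrac{1}{2} q^9\right),$$ $$\left(0,\; \tfrac{1}{2} (q^5-2 q^4+4 q^2-4 q+1) q^3,\; \tfrac{1}{4} (q^7-2 q^6+4 q^4-5 q^3+q^2+2 q-1) q^2,\; \tfrac{1}{4} (q^8-4 q^7+6 q^6-2 q^5-7 q^4+9 q^3-2 q^2-3 q+2) q\right),$$ $$\left(0,\; \tfrac{1}{2} (q^7-2 q^6+4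 q^4-5 q^3+q^2+2 q-1) q,\; \tfrac{1}{4} (q^8-2 q^7+4 q^5-6 q^4+3 q^3+3 q^2-5 q+2) q,\; \tfrac{1}{4} (q^8-4 q^7+6 q^6-2 q^5-6 q^4+9 q^3-3 q^2-3 q+2) q\right),$$ $$\left(1,\; \tfrac{1}{2} q^8-q^7+2 q^5-\tfrac{5}{2} q^4-\tfrac{3}{2} q^3+2 q^2-\tfrac{1}{2} q-1,\; \tfrac{1}{4} (q^8-2 q^7+4 q^5-4 q^4-q^3+5 q^2-q-2) q,\; \tfrac{1}{4} (q^8-4 q^7+6 q^6-2 q^5-8 q^4+13 q^3+3 q^2-11 q+6) q\right).$$
   Context: Association schemes. Let $X$ be a nonempty finite set and let $\mathcal{R}_0,\mathcal{R}_1,\dots,\mathcal{R}_d$ be symmetric relations partitioning $X\times X$ with $\mathcal{R}_0=\{(x,x): x\in X\}$. Let $A_i$ be the adjacency matrix of $\mathcal{R}_i$ (its $(x,y)$ entry is $1$ if $(x,y)\in \mathcal{R}_i$ and $0$ otherwise). $(X,\{\mathcal{R}_i\}_{i=0}^d)$ is a $d$-class association scheme if there are numbers $p_{i,j}^k$ (the intersection numbers) with $A_iA_j=\sum_{k=0}^d p_{i,j}^kA_k$ for all $i,j$. The matrix $B_i$ is defined by $A_i(A_0,A_1,\dots,A_d)=(A_0,A_1,\dots,A_d)B_i$, so its $(k,j)$ entry is $p_{i,j}^k$. If $X$ is a finite additive abelian group and $S_0=\{0\},S_1,\dots,S_d$ is a partition of $X$, then ''$(X,\{S_i\}_{i=0}^d)$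 is an association scheme'' means that the relations $\mathcal{R}_i=\{(x,x+y): x\in X,\ y\in S_i\}$ form an association scheme on $X$. Fields and cyclotomic classes. Let $E=\mathbb{F}_{2^s}$, $F=\mathbb{F}_{2^{3s}}$, $G=\mathbb{F}_{2^{6s}}$, $H=\mathbb{F}_{2^{9s}}$, where $E\subset F$, $F\subset G$ and $F\subset H$; $\mathrm{Tr}_{F/E}$ is the trace from $F$ to $E$, and $\mathrm{Norm}_{G/F}$, $\mathrm{Norm}_{H/F}$ are the norms to $F$. Fix a primitive element $\beta$ of $H$ and a primitive element $\gamma$ of $G$ with $\mathrm{Norm}_{H/F}(\beta)=\mathrm{Norm}_{G/F}(\gamma)$, and put $\omega:=\mathrm{Norm}_{H/F}(\beta)=\mathrm{Norm}_{G/F}(\gamma)$, a primitive element of $F$. The cyclotomic classes of order $M$ are $C_i^{(M,G)}=\gamma^i\langle\gamma^M\rangle\subset G^*$ and $C_i^{(M,H)}=\beta^i\langle\beta^M\rangle\subset H^*$; they depend only on $i$ modulo $M$. The partition of $\mathbb{Z}_M$. For $a\in\mathbb{Z}_M$ let $$S_a:=\{u\in F^*: \mathrm{Tr}_{F/E}(u^{1+2^s})=0,\ \mathrm{Tr}_{F/E}(\omega^a u)=0\}.$$ The size of $S_a$ depends only on $a$ modulo $M$ and is always $0$, $2^s-1$ or $2(2^s-1)$. Let $T_1$ be the set of $a\in\mathbb{Z}_M$ with $|S_a|=2^s-1$, $T_2$ the set of $a\in\mathbb{Z}_M$ with $|S_a|=2(2^s-1)$, and $T_3=\mathbb{Z}_M\setminus(T_1\cup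 T_2)$ (so $|S_a|=0$ for $a\in T_3$). *)

(* Defs.v *)
From HB Require Import structures.
From mathcomp Require Import all_boot all_order all_algebra all_fingroup.
From mathcomp Require Import all_solvable all_field.

Set Implicit Arguments.
Unset Strict Implicit.
Unset Printing Implicit Defensive.

Import GRing.Theory.
Local Open Scope ring_scope.

Definition adj_mx (X : finType) (R : {set X * X}) : 'M[rat]_#|X| :=
  \matrix_(x, y) ((enum_val x, enum_val y) \in R)%:R.

(* [partition] makes every relation nonempty, and injectivity of R keeps the
   d.+1 relations pairwise distinct.  The intersection number p_{i,j}^k is
   [p i j k]. *)
Definition association_scheme (d : nat) (X : finType)
    (R : 'I_d.+1 -> {set X * X}) : Prop :=
  [/\ injective R /\ partition [set R i | i : 'I_d.+1] [set: X * X],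
      R ord0 = [set (x, x) | x : X],
      forall i x y, ((x, y) \in R i) = ((y, x) \in R i) &
      exists p : 'I_d.+1 -> 'I_d.+1 -> 'I_d.+1 -> rat,
        forall i j,
          adj_mx (R i) *m adj_mx (R j) = \sum_k p i j k *: adj_mx (R k)].

(* A_i (A_0, ..., A_d) = (A_0, ..., A_d) B, read block by block. *)
Definition intersection_matrix (d : nat) (X : finType)
    (R : 'I_d.+1 -> {set X * X}) (i : 'I_d.+1) (B : 'M[rat]_d.+1) : Prop :=
  forall j, adj_mx (R i) *m adj_mx (R j) = \sum_k B k j *: adj_mx (R k).

Definition translation_rel (d : nat) (X : finZmodType)
    (S : 'I_d.+1 -> {set X}) (i : 'I_d.+1) : {set X * X} :=
  [set (x, x + y) | x : X, y : X in S i].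

Definition primitive_element (K : finFieldType) (g : {unit K}) : bool :=
  generator [set: {unit K}] g.

Definition cyclotomic_class (K : finFieldType) (g : {unit K}) (M i : nat) :
    {set K} :=
  [set val u | u in (g ^+ i *: <[g ^+ M]>)%g].

(* The order M; it is at least 7 when 0 < s, so that 'Z_(ord_M s) is Z/M. *)
Definition ord_M (s : nat) : nat := (2 ^ (3 * s) - 1) %/ (2 ^ s - 1).

(* The alias [finvect_type K] gives an extension K of a finite field k its
   finite field structure.  The trace and the norm of K / k are elements of K,
   lying in the copy of k inside K. *)
Definition rel_trace (k : finFieldType) (K : fieldExtType k)
    (x : finvect_type K) : finvect_type K :=
  galTrace 1%AS {:finvect_type K}%AS x.

Definition rel_norm (k : finFieldType) (K : fieldExtType k)
    (x : finvect_type K) : finvect_type K :=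
  galNorm 1%AS {:finvect_type K}%AS x.

Section IndexPartition.
Variables (s : nat) (E : finFieldType) (F : fieldExtType E).
Variable omega : finvect_type F.

Definition S_ (a : nat) : {set finvect_type F} :=
  [set u | [&& u != 0, rel_trace (u ^+ (1 + 2 ^ s)) == 0 &
               rel_trace (omega ^+ a * u) == 0]].

Definition T1 : {set 'Z_(ord_M s)} :=
  [set a : 'Z_(ord_M s) | #|S_ a| == 2 ^ s - 1]%N.
Definition T2 : {set 'Z_(ord_M s)} :=
  [set a : 'Z_(ord_M s) | #|S_ a| == 2 * (2 ^ s - 1)]%N.
Definition T3 : {set 'Z_(ord_M s)} := ~: (T1 :|: T2).

Definition cyclotomic_partition (K : finFieldType) (g : {unit K}) :
    'I_4 -> {set K} :=
  tnth [tuple [set 0];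
              \bigcup_(i in T1) cyclotomic_class g (ord_M s) i;
              \bigcup_(i in T2) cyclotomic_class g (ord_M s) i;
              \bigcup_(i in T3) cyclotomic_class g (ord_M s) i].

End IndexPartition.

Definition mx_of_rows (rows : seq (seq rat)) : 'M[rat]_4 :=
  \matrix_(k, j) (nth [::] rows k)`_j.

Definition BG1 (q : rat) : 'M[rat]_4 := mx_of_rows
  [:: [:: 0; q ^+ 5 + q ^+ 2 - q ^+ 3 - 1; 0; 0];
      [:: 1;
          - q ^+ 3 + q ^+ 2 + q ^+ 4 - 2;
          1 / 2 * q ^+ 3 * (q ^+ 2 - 1);
          1 / 2 * (q ^+ 2 - 2 * q + 1) * q ^+ 3];
      [:: 0;
          (q - 1) * q ^+ 2 * (q + 1);
          1 / 2 * (q - 1) * (q ^+ 4 + q ^+ 3 - q ^+ 2 + q + 2);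
          1 / 2 * (q - 1) * q * (q ^+ 3 - q ^+ 2 - q + 1)];
      [:: 0;
          (q - 1) * q ^+ 2 * (q + 1);
          1 / 2 * q * (q ^+ 3 - q ^+ 2 - q + 1) * (q + 1);
          1 / 2 * (q ^+ 4 - 2 - 3 * q ^+ 3 + 3 * q ^+ 2 + q) * (q + 1)]].

Definition BG2 (q : rat) : 'M[rat]_4 := mx_of_rows
  [:: [:: 0;
          0;
          1 / 2 * q ^+ 6 - 1 / 2 * q ^+ 4 + 1 / 2 * q ^+ 3 - 1 / 2 * q;
          0];
      [:: 0;
          1 / 2 * q ^+ 3 * (q ^+ 2 - 1);
          1 / 4 * (q ^+ 5 - 2 * q ^+ 3 + 2 * q ^+ 2 + q - 2) * q;
          1 / 4 * (-1 + q ^+ 4 + 2 * q - 2 * q ^+ 3) * q ^+ 2];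
      [:: 1;
          1 / 2 * (q - 1) * (q ^+ 4 + q ^+ 3 - q ^+ 2 + q + 2);
          1 / 4 * (q ^+ 5 - 3 * q ^+ 3 + 3 * q ^+ 2 + q - 6) * q;
          1 / 4 * q * (q ^+ 4 - 2 - q ^+ 3 + 3 * q) * (q - 1)];
      [:: 0;
          1 / 2 * q * (q ^+ 3 - q ^+ 2 - q + 1) * (q + 1);
          1 / 4 * q * (q ^+ 4 - 2 - q ^+ 3 + 3 * q) * (q + 1);
          1 / 4 * q * (q ^+ 4 - 2 - 3 * q ^+ 3 + 2 * q ^+ 2 + q) * (q + 1)]].

Definition BG3 (q : rat) : 'M[rat]_4 := mx_of_rows
  [:: [:: 0;
          0;
          0;
          - q ^+ 2 + 1 / 2 * q ^+ 3 - q ^+ 5 + 1 / 2 * q + 1 / 2 * q ^+ 4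
            + 1 / 2 * q ^+ 6];
      [:: 0;
          1 / 2 * (q ^+ 2 - 2 * q + 1) * q ^+ 3;
          1 / 4 * (-1 + q ^+ 4 + 2 * q - 2 * q ^+ 3) * q ^+ 2;
          1 / 4 * (q ^+ 5 - 4 * q ^+ 4 + 6 * q ^+ 3 - 2 * q ^+ 2 - 3 * q + 2) * q];
      [:: 0;
          1 / 2 * (q - 1) * q * (q ^+ 3 - q ^+ 2 - q + 1);
          1 / 4 * q * (q ^+ 4 - 2 - q ^+ 3 + 3 * q) * (q - 1);
          1 / 4 * q * (q ^+ 4 - 2 - 3 * q ^+ 3 + 2 * q ^+ 2 + q) * (q - 1)];
      [:: 1;
          1 / 2 * (q ^+ 4 - 2 - 3 * q ^+ 3 + 3 * q ^+ 2 + q) * (q + 1);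
          1 / 4 * q * (q ^+ 4 - 2 - 3 * q ^+ 3 + 2 * q ^+ 2 + q) * (q + 1);
          1 / 4 * q * (q ^+ 5 + 6 + 7 * q ^+ 3 - q ^+ 2 - 4 * q ^+ 4 - 11 * q)]].

Definition BH1 (q : rat) : 'M[rat]_4 := mx_of_rows
  [:: [:: 0; q ^+ 8 + q ^+ 5 + q ^+ 2 - q ^+ 6 - q ^+ 3 - 1; 0; 0];
      [:: 1;
          q ^+ 7 - 2 * q ^+ 5 + 2 * q ^+ 4 - q ^+ 3 + q ^+ 2 - 2;
          1 / 2 * (q ^+ 5 - 2 * q ^+ 3 + 2 * q ^+ 2 - 1) * q ^+ 3;
          1 / 2 * (q ^+ 5 - 2 * q ^+ 4 + 4 * q ^+ 2 - 4 * q + 1) * q ^+ 3];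
      [:: 0;
          (q ^+ 5 - 2 * q ^+ 3 + 2 * q ^+ 2 - 1) * q ^+ 2;
          1 / 2 * q ^+ 8 - q ^+ 6 + q ^+ 5 + 1 / 2 * q ^+ 4 - 3 / 2 * q ^+ 3
            + q ^+ 2 + 1 / 2 * q - 1;
          1 / 2 * (q ^+ 7 - 2 * q ^+ 6 + 4 * q ^+ 4 - 5 * q ^+ 3 + q ^+ 2 + 2 * q - 1) * q];
      [:: 0;
          (q ^+ 5 - 2 * q ^+ 3 + 2 * q ^+ 2 + 2 * q - 1) * q ^+ 2;
          1 / 2 * (q ^+ 7 - 2 * q ^+ 5 + 2 * q ^+ 4 + q ^+ 3 - 3 * q ^+ 2 + 1) * q;
          1 / 2 * q ^+ 8 - q ^+ 7 + 2 * q ^+ 5 - 5 / 2 * q ^+ 4 - 3 / 2 * q ^+ 3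
            + 2 * q ^+ 2 - 1 / 2 * q - 1]].

Definition BH2 (q : rat) : 'M[rat]_4 := mx_of_rows
  [:: [:: 0;
          0;
          -1 / 2 * q - 1 / 2 * q ^+ 4 + 1 / 2 * q ^+ 3 + 1 / 2 * q ^+ 6
            - 1 / 2 * q ^+ 7 + 1 / 2 * q ^+ 9;
          0];
      [:: 0;
          1 / 2 * (q ^+ 5 - 2 * q ^+ 3 + 2 * q ^+ 2 - 1) * q ^+ 3;
          1 / 4 * (q ^+ 8 - 2 * q ^+ 6 + 2 * q ^+ 5 + q ^+ 4 - 3 * q ^+ 3 + 2 * q ^+ 2 + q - 2) * q;
          1 / 4 * (q ^+ 7 - 2 * q ^+ 6 + 4 * q ^+ 4 - 5 * q ^+ 3 + q ^+ 2 + 2 * q - 1) * q ^+ 2];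
      [:: 1;
          1 / 2 * q ^+ 8 - q ^+ 6 + q ^+ 5 + 1 / 2 * q ^+ 4 - 3 / 2 * q ^+ 3
            + q ^+ 2 + 1 / 2 * q - 1;
          1 / 4 * (q ^+ 8 - 2 * q ^+ 6 + 2 * q ^+ 5 + 2 * q ^+ 4 - 7 * q ^+ 3 + 5 * q ^+ 2 + q - 6) * q;
          1 / 4 * (q ^+ 8 - 2 * q ^+ 7 + 4 * q ^+ 5 - 6 * q ^+ 4 + 3 * q ^+ 3 + 3 * q ^+ 2 - 5 * q + 2) * q];
      [:: 0;
          1 / 2 * (q ^+ 7 - 2 * q ^+ 5 + 2 * q ^+ 4 + q ^+ 3 - 3 * q ^+ 2 + 1) * q;
          1 / 4 * (q ^+ 8 - 2 * q ^+ 6 + 2 * q ^+ 5 - 3 * q ^+ 3 + 3 * q ^+ 2 + q - 2) * q;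
          1 / 4 * (q ^+ 8 - 2 * q ^+ 7 + 4 * q ^+ 5 - 4 * q ^+ 4 - q ^+ 3 + 5 * q ^+ 2 - q - 2) * q]].

Definition BH3 (q : rat) : 'M[rat]_4 := mx_of_rows
  [:: [:: 0;
          0;
          0;
          1 / 2 * q - q ^+ 2 + 1 / 2 * q ^+ 4 + 1 / 2 * q ^+ 3 - q ^+ 5
            + 1 / 2 * q ^+ 6 - q ^+ 8 + 1 / 2 * q ^+ 7 + 1 / 2 * q ^+ 9];
      [:: 0;
          1 / 2 * (q ^+ 5 - 2 * q ^+ 4 + 4 * q ^+ 2 - 4 * q + 1) * q ^+ 3;
          1 / 4 * (q ^+ 7 - 2 * q ^+ 6 + 4 * q ^+ 4 - 5 * q ^+ 3 + q ^+ 2 + 2 * q - 1) * q ^+ 2;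
          1 / 4 * (q ^+ 8 - 4 * q ^+ 7 + 6 * q ^+ 6 - 2 * q ^+ 5 - 7 * q ^+ 4 + 9 * q ^+ 3 - 2 * q ^+ 2 - 3 * q + 2) * q];
      [:: 0;
          1 / 2 * (q ^+ 7 - 2 * q ^+ 6 + 4 * q ^+ 4 - 5 * q ^+ 3 + q ^+ 2 + 2 * q - 1) * q;
          1 / 4 * (q ^+ 8 - 2 * q ^+ 7 + 4 * q ^+ 5 - 6 * q ^+ 4 + 3 * q ^+ 3 + 3 * q ^+ 2 - 5 * q + 2) * q;
          1 / 4 * (q ^+ 8 - 4 * q ^+ 7 + 6 * q ^+ 6 - 2 * q ^+ 5 - 6 * q ^+ 4 + 9 * q ^+ 3 - 3 * q ^+ 2 - 3 * q + 2) * q];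
      [:: 1;
          1 / 2 * q ^+ 8 - q ^+ 7 + 2 * q ^+ 5 - 5 / 2 * q ^+ 4 - 3 / 2 * q ^+ 3
            + 2 * q ^+ 2 - 1 / 2 * q - 1;
          1 / 4 * (q ^+ 8 - 2 * q ^+ 7 + 4 * q ^+ 5 - 4 * q ^+ 4 - q ^+ 3 + 5 * q ^+ 2 - q - 2) * q;
          1 / 4 * (q ^+ 8 - 4 * q ^+ 7 + 6 * q ^+ 6 - 2 * q ^+ 5 - 8 * q ^+ 4 + 13 * q ^+ 3 + 3 * q ^+ 2 - 11 * q + 6) * q]].

(* Main.v *)
Require Import Defs.
From HB Require Import structures.
From mathcomp Require Import all_boot all_order all_algebra all_fingroup.
From mathcomp Require Import all_solvable all_field.
From mathcomp Require Import ring lra zify.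

Set Implicit Arguments.
Unset Strict Implicit.
Unset Printing Implicit Defensive.

Import Order.TTheory GRing.Theory Num.Theory.
Local Open Scope ring_scope.

(** Put q = 2^s, let K be the field of order q^3 and E its subfield of order q.

    The elements of K, up to factors in E, are the points of the projective
    plane of order q.  There Tr(u^(1+q)) = 0 is a conic with nucleus E: its
    points are the inverses of the nonzero elements of trace 0, since
    Tr(u^(1+q)) = N(u) Tr(1/u).  The set S_a is the cone over the intersection
    of the conic with the line Tr(omega^a u) = 0, so that T1, T2, T3 index
    the tangent, secant and external lines.  The tangents are the lines through
    the nucleus, the lines of trace 0 ([card_conic_line_tangent]).  The points of
    the conic on any other line, of coefficient w, are permuted without fixed point
    by u -> 1/(w u), and there are 0 or 2 of them ([card_conic_line_secant]).
    Taking norms to K, an element x of the big field L lies in R_i if and only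
    if the line with coefficient N(x) belongs to the i-th family
    ([cyclotomic_partitionE]).

    A partition of L is a translation scheme with intersection numbers p as soon
    as the character sums e_i(y) = sum over R_i of chi(x y) satisfy
    e_i e_j = sum_k p_ij^k e_k at every y, by Fourier inversion
    ([convolution_of_eigenvalues]).  In characteristic 2 the character chi is
    (-1)^(absolute trace), so everything takes place over the rationals.

    For a function f of the norm, the transform of f(N(x)) at y is the value at
    N(y) of the multiplicative convolution over K of w -> f(1/w) with
    w -> sum over N(x) = w of psi(Tr x).  By the Davenport-Hasse relation this
    last function is -(psi * psi) on the quadratic extension and
    psi * psi * psi on the cubic one ([fibre_sum2], [fibre_sum3]).  These two
    cases are elementary.  For a quadratic polynomial over K, the number of
    elements of the quadratic extension having it as characteristic polynomial
    and the number of its roots in K add up to 2 ([quadratic_count]).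
    A similar count gives 3 for cubics ([cubic_count]).  Both follow from an upper
    bound for each polynomial and the equality of the totals.

    It remains to convolve repeatedly with psi.  This operator turns the
    indicators of E, of trace 0, of the conic, and the number of conic points on
    a line into affine combinations of one another ([mconv_in_E],
    [mconv_kappa], [mconv_tau], [mconv_points_inv]).  The eigenvalues are thereby
    explicit polynomials in q, taking three rows of values away from y = 0, and
    the stated matrices satisfy the required identities ([eigenrow_G],
    [eigenrow_H]). *)

(** * Frobenius powers and the additive character of the absolute trace *)

Section FrobeniusPower.
Variables (K : fieldType).
Hypothesis char2 : 2 \in [pchar K].

Lemma frobD i (x y : K) : (x + y) ^+ (2 ^ i) = x ^+ (2 ^ i) + y ^+ (2 ^ i).
Proof. by rewrite exprDn_pchar // pnatX pnatE // char2. Qed.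

Lemma frob_sum i (I : Type) (r : seq I) (P : pred I) (f : I -> K) :
  (\sum_(j <- r | P j) f j) ^+ (2 ^ i) = \sum_(j <- r | P j) f j ^+ (2 ^ i).
Proof.
by apply: (big_morph (fun x => x ^+ (2 ^ i))) => [x y|]; rewrite ?frobD // expr0n expn_eq0.
Qed.

Lemma frob_inj i : injective (fun x : K => x ^+ (2 ^ i)).
Proof.
move=> x y /= /eqP; rewrite -subr_eq0 (oppr_pchar2 char2) -frobD.
by rewrite expf_eq0 expn_gt0 /= addr_eq0 (oppr_pchar2 char2) => /eqP.
Qed.

End FrobeniusPower.

Section AbsoluteTrace.
Variables (K : finFieldType).
Hypothesis char2 : 2 \in [pchar K].

Definition abs_trace m (x : K) : K := \sum_(i < m) x ^+ (2 ^ i).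

Definition frob_fixed m : {set K} := [set x | x ^+ (2 ^ m) == x].

Lemma abs_traceD m x y : abs_trace m (x + y) = abs_trace m x + abs_trace m y.
Proof. by rewrite -big_split; apply: eq_bigr => i _; rewrite frobD. Qed.

(** Transitivity of the trace, in terms of Frobenius powers alone: the inner sum is
    the trace to the subfield of order 2^m. *)
Lemma abs_trace_tower m n x :
  abs_trace (m * n) x = abs_trace m (\sum_(j < n) x ^+ (2 ^ (m * j))).
Proof.
rewrite /abs_trace; under [RHS]eq_bigr do rewrite frob_sum //.
under [RHS]eq_bigr do under eq_bigr do rewrite -exprM -expnD.
elim: n => [|n IH]; first by rewrite muln0 big_ord0 big1 // => i _; rewrite big_ord0.
rewrite mulnS addnC big_split_ord IH /=; under [RHS]eq_bigr do rewrite big_ord_recr /=.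
by rewrite big_split.
Qed.

Lemma abs_trace_bool m x : x \in frob_fixed m ->
  (abs_trace m x == 0) || (abs_trace m x == 1).
Proof.
rewrite inE => /eqP xfix.
rewrite -subr_eq0 -[_ == 1]subr_eq0 -mulf_eq0 subr0 mulrBr mulr1 subr_eq0.
rewrite -expr2 -(expn1 2) /abs_trace frob_sum //.
under eq_bigr do rewrite -exprM -expnD addn1.
case: m xfix => [|m] xfix; first by rewrite !big_ord0.
by rewrite big_ord_recr big_ord_recl /= xfix expn0 expr1 addrC.
Qed.

(** The character (-1)^(abs_trace m x), where the trace is 0 or 1 on the elements
    fixed by the m-th Frobenius power. *)
Definition add_char m x : rat := if abs_trace m x == 0 then 1 else -1.

Lemma add_char0 m : add_char m 0 = 1.
Proof.
rewrite /add_char /abs_trace big1 ?eqxx // => i _.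
by rewrite expr0n expn_eq0.
Qed.

Lemma add_charD m x y : x \in frob_fixed m -> y \in frob_fixed m ->
  add_char m (x + y) = add_char m x * add_char m y.
Proof.
rewrite /add_char abs_traceD => /abs_trace_bool /orP[]/eqP-> /abs_trace_bool /orP[]/eqP->;
by rewrite ?addr0 ?add0r ?(addrr_pchar2 char2) ?eqxx ?oner_eq0 ?mulrNN ?mulr1 ?mul1r.
Qed.

Lemma frob_fixedM m x y :
  x \in frob_fixed m -> y \in frob_fixed m -> x * y \in frob_fixed m.
Proof. by rewrite !inE exprMn => /eqP-> /eqP->. Qed.

Lemma frob_fixedD m x y :
  x \in frob_fixed m -> y \in frob_fixed m -> x + y \in frob_fixed m.
Proof. by rewrite !inE frobD // => /eqP-> /eqP->. Qed.

Lemma frob_fixedV m x :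
  x \in frob_fixed m -> x^-1 \in frob_fixed m.
Proof. by rewrite !inE exprVn => /eqP->. Qed.

(** The trace is a polynomial of degree 2^(m-1), too small to vanish on a field of
    order 2^m. *)
Lemma add_char_nontrivial m : (0 < m)%N -> #|frob_fixed m| = (2 ^ m)%N ->
  exists2 x, x \in frob_fixed m & add_char m x = -1.
Proof.
case: m => // m _ cardm.
have [/existsP[x /andP[xf tx]]|] :=
    boolP [exists x, (x \in frob_fixed m.+1) && (abs_trace m.+1 x != 0)].
  by exists x => //; rewrite /add_char (negPf tx).
rewrite negb_exists => /forallP alltr.
pose p : {poly K} := \sum_(i < m.+1) 'X^(2 ^ i).
have szp : (size p <= (2 ^ m).+1)%N.
  apply: (leq_trans (size_sum _ _ _)); apply/bigmax_leqP => i _.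
  by rewrite size_polyXn ltnS leq_exp2l // -ltnS.
have p_neq0 : p != 0.
  apply/eqP => /(congr1 (fun p : {poly K} => p`_1)) /eqP.
  rewrite coef0 coef_sum big_ord_recl big1 ?addr0 ?coefXn ?oner_eq0 //.
  by move=> i _; rewrite coefXn /= expnS mul2n; case: eqP => // /(congr1 odd); rewrite odd_double.
have := @max_poly_roots _ p (enum (frob_fixed m.+1)) p_neq0.
rewrite enum_uniq -cardE cardm => /(_ _ isT) lt.
suff /lt : all (root p) (enum (frob_fixed m.+1)).
  move/leq_trans => /(_ _ szp); rewrite ltnS leq_exp2l // ltnn //.
apply/allP => x; rewrite mem_enum => xf; have := alltr x.
rewrite xf negbK => /= tr0; rewrite /root /p horner_sum.
by under eq_bigr do rewrite hornerXn.
Qed.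

(** Orthogonality: translating the sum by an element of character -1 changes its
    sign. *)
Lemma sum_add_char m b : (0 < m)%N -> #|frob_fixed m| = (2 ^ m)%N ->
    b \in frob_fixed m ->
  \sum_(x in frob_fixed m) add_char m (x * b) = if b == 0 then (2 ^ m)%:R else 0.
Proof.
move=> m_gt0 cardm bf; case: eqP => [->|/eqP b_neq0].
  under eq_bigr do rewrite mulr0 add_char0.
  by rewrite sumr_const cardm.
have [y yf cy] := add_char_nontrivial m_gt0 cardm.
set S := LHS; suff : S = - S by lra.
(* y / b is chosen so that multiplication by b gives y, of character -1 *)
rewrite /S [LHS](reindex_inj (addrI (y / b))) /= -sumrN.
have ybf : y / b \in frob_fixed m by rewrite frob_fixedM ?frob_fixedV.
have shift x : (y / b + x \in frob_fixed m) = (x \in frob_fixed m).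
  apply/idP/idP => [xf|]; last exact: frob_fixedD.
  have -> : x = y / b + (y / b + x) by rewrite addrA (addrr_pchar2 char2) add0r.
  exact: frob_fixedD.
apply: eq_big => // x; rewrite shift => xf.
by rewrite mulrDl divfK // add_charD ?frob_fixedM // cy mulN1r.
Qed.

Lemma sum_add_char_full m b : (0 < m)%N -> #|K| = (2 ^ m)%N ->
  \sum_x add_char m (x * b) = if b == 0 then #|K|%:R else 0.
Proof.
move=> m_gt0 cardK; have fixK x : x \in frob_fixed m by rewrite inE -cardK expf_card.
have cardm : #|frob_fixed m| = (2 ^ m)%N.
  by rewrite -cardK; apply: eq_card => x; rewrite fixK.
rewrite cardK -(sum_add_char m_gt0 cardm (fixK b)).
by apply: eq_bigl => x; rewrite fixK.
Qed.

End AbsoluteTrace.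

(** * Elements of a quadratic extension with given trace and norm *)

Section CountingLemmas.

Lemma sum_card_fibers (I J : finType) (g : I -> J) :
  (\sum_(j : J) #|[set i | g i == j]| = #|I|)%N.
Proof.
rewrite -sum1_card (partition_big g predT) //=; apply: eq_bigr => j _.
by rewrite -sum1_card; apply: eq_bigl => i; rewrite inE.
Qed.

(** Turns an upper bound for every polynomial and the count over all polynomials
    into an exact count for each of them. *)
Lemma bounded_sum_tight (I : finType) (f : I -> nat) (c : nat) :
    (forall i, f i <= c)%N -> (\sum_i f i = #|I| * c)%N ->
  forall i, f i = c.
Proof.
move=> le_c sum_c i; have := leqif_sum (P := predT) (fun j _ => leqif_eq (le_c j)).
rewrite sum_nat_const => -[_]; rewrite sum_c eqxx => /esym/forallP/(_ i)/eqP.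
exact.
Qed.

End CountingLemmas.

Section Extension.
Variables (K L : finFieldType) (iota : {rmorphism K -> L}).

Lemma in_subfield_frob (y : L) : (y ^+ #|K| == y) = (y \in codom iota).
Proof.
apply/eqP/idP => [yfix|/codomP[a ->]]; last by rewrite -rmorphXn expf_card.
(* An element fixed by Frobenius and outside K would be one root too many. *)
pose p : {poly L} := 'X^#|K| - 'X.
have szp : size p = #|K|.+1.
  by rewrite size_polyDl size_polyXn // size_polyN size_polyX ltnS finNzRing_gt1.
have p_neq0 : p != 0 by rewrite -size_poly_eq0 szp.
have root_p z : z ^+ #|K| = z -> root p z.
  by move=> zfix; rewrite /root /p !hornerE zfix subrr.
apply: contraT => ynotin.
have := @max_poly_roots _ p (y :: codom iota) p_neq0.
rewrite szp /= size_codom ltnn ynotin map_inj_uniq ?enum_uniq; last exact: fmorph_inj.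
rewrite root_p //=; apply=> //; apply/allP => z /codomP[a ->].
by apply: root_p; rewrite -rmorphXn expf_card.
Qed.

(** The inverse of [iota] on its image; it makes traces and norms K-valued. *)
Definition retract (y : L) : K := odflt 0 [pick a | iota a == y].

Lemma retractK y : y ^+ #|K| = y -> iota (retract y) = y.
Proof.
move=> /eqP; rewrite in_subfield_frob => /codomP[a ->]; rewrite /retract.
by case: pickP => [b /eqP->//|/(_ a)]; rewrite eqxx.
Qed.

Lemma card_frob_fixed_sub : #|[set y : L | y ^+ #|K| == y]| = #|K|.
Proof.
rewrite -[RHS](card_codom (fmorph_inj iota)); apply: eq_card => y.
by rewrite inE in_subfield_frob.
Qed.

End Extension.

Section Quadratic.
Variables (K G : finFieldType) (iota : {rmorphism K -> G}) (m : nat).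
Hypotheses (cardK : #|K| = (2 ^ m)%N) (cardG : #|G| = (2 ^ (m * 2))%N).
Hypotheses (char2 : 2 \in [pchar K]).

Let char2G : 2 \in [pchar G]. Proof. by rewrite (fmorph_pchar iota). Qed.
Let fr (x : G) := x ^+ (2 ^ m).
Let fr2 x : fr (fr x) = x.
Proof. by rewrite /fr -exprM -expnD addnn -muln2 -cardG expf_card. Qed.
Let frI a : fr (iota a) = iota a.
Proof. by rewrite /fr -cardK -rmorphXn expf_card. Qed.

Definition tr2 (x : G) : K := retract iota (x + x ^+ (2 ^ m)).
Definition nm2 (x : G) : K := retract iota (x * x ^+ (2 ^ m)).

Lemma tr2E x : iota (tr2 x) = x + x ^+ (2 ^ m).
Proof. by rewrite retractK // cardK frobD // -!/(fr _) fr2 addrC. Qed.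

Lemma nm2E x : iota (nm2 x) = x * x ^+ (2 ^ m).
Proof. by rewrite retractK // cardK exprMn -!/(fr _) fr2 mulrC. Qed.

(** If T^2 - t T + w has a root in K, an element of G with this characteristic
    polynomial is one of its roots, hence in K, and the polynomial is a square; if it has
    none, the elements counted are among its two roots. *)
Lemma quadratic_count_le t w :
  (#|[set x : G | (tr2 x, nm2 x) == (t, w)]|
   + #|[set a : K | (a ^+ 2 - t * a + w == 0)%R]| <= 2)%N.
Proof.
set A := [set x | _]; set Z := [set a | _].
have rootA x : x \in A -> x ^+ 2 - iota t * x + iota w = 0.
  by rewrite inE => /eqP[<- <-]; rewrite tr2E nm2E; ring.
have [->|[a aZ]] := set_0Vmem Z.
  rewrite cards0 addn0; have [->|[x xA]] := set_0Vmem A; first by rewrite cards0.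
  apply: (leq_trans (subset_leq_card (_ : _ \subset [set x; iota t - x]))).
    apply/subsetP => y yA; rewrite !inE -subr_eq0 -[y == _ - _]subr_eq0 -mulf_eq0.
    by rewrite -(subrr 0) -{1}(rootA _ yA) -(rootA _ xA); apply/eqP; ring.
  by rewrite cards2; case: eqP.
have aroot : a ^+ 2 - t * a + w = 0 by move: aZ; rewrite inE => /eqP.
have wE : w = a * (t - a) by apply/eqP; rewrite -subr_eq0 -aroot; apply/eqP; ring.
have Zsub : Z \subset [set a; t - a].
  apply/subsetP => b; rewrite !inE => /eqP broot.
  rewrite -subr_eq0 -[b == _ - _]subr_eq0 -mulf_eq0 -broot wE.
  by apply/eqP; ring.
have Asub x : x \in A -> [/\ x = iota a & t = 0].
  move=> xA; have xK : x \in [set iota a; iota (t - a)].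
    rewrite !inE -subr_eq0 -[x == iota (_ - _)]subr_eq0 -mulf_eq0 -(rootA _ xA) wE.
    by rewrite !(rmorphM, rmorphB); apply/eqP; ring.
  have t0 : t = 0.
    move: xA; rewrite inE => /eqP[<- _]; apply: (fmorph_inj iota).
    rewrite tr2E rmorph0 -/(fr x).
    by move: xK; rewrite !inE => /orP[]/eqP->; rewrite frI (addrr_pchar2 char2G).
  split=> //; move: xK; rewrite !inE t0 sub0r (oppr_pchar2 char2) orbb.
  by move/eqP.
have [->|[x /Asub[_ t0]]] := set_0Vmem A.
  rewrite cards0; apply: leq_trans (subset_leq_card Zsub) _.
  by rewrite cards2; case: eqP.
rewrite -[2%N]/(1 + 1)%N; apply: leq_add.
  rewrite -(cards1 (iota a)); apply/subset_leq_card/subsetP => y /Asub[-> _].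
  by rewrite inE.
rewrite -(cards1 a); apply: leq_trans (subset_leq_card Zsub) _.
by rewrite t0 sub0r (oppr_pchar2 char2) setUid.
Qed.

(** The two terms have the same total over all (t, w), namely the square of the
    order of K. *)
Lemma quadratic_count t w :
  (#|[set x : G | (tr2 x, nm2 x) == (t, w)]|
   + #|[set a : K | (a ^+ 2 - t * a + w == 0)%R]| = 2)%N.
Proof.
pose roots (p : K * K) := [set a : K | a ^+ 2 - p.1 * a + p.2 == 0].
pose f p := (#|[set x : G | (tr2 x, nm2 x) == p]| + #|roots p|)%N.
rewrite -[LHS]/(f (t, w)); apply: bounded_sum_tight => [[t1 w1]|].
  exact: quadratic_count_le.
rewrite big_split /= sum_card_fibers.
(* A root and the trace determine the constant coefficient. *)
have rootsE p : #|roots p| = #|[set i : K * K | (i.2, i.2 * i.1 - i.1 ^+ 2) == p]|.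
  case: p => t1 w1; have inj_pair : injective (fun a : K => (a, t1)) by move=> a b [].
  rewrite -(card_imset _ inj_pair).
  apply: eq_card => -[a t']; rewrite inE.
  apply/imsetP/idP => /= [[b]|/eqP[<- <-]].
    rewrite inE /= => /eqP b0 [-> ->]; rewrite xpair_eqE eqxx /=.
    by rewrite -subr_eq0 -oppr_eq0 -b0; apply/eqP; ring.
  by exists a => //; rewrite inE /=; apply/eqP; ring.
under eq_bigr do rewrite rootsE.
rewrite sum_card_fibers cardG !card_prod cardK expnM.
by rewrite muln2 addnn.
Qed.

End Quadratic.

(** * Elements of a cubic extension with given characteristic polynomial *)

Section Cubic.
Variables (K G H : finFieldType).
Variables (iota2 : {rmorphism K -> G}) (iota3 : {rmorphism K -> H}) (m : nat).
Hypotheses (cardK : #|K| = (2 ^ m)%N) (cardG : #|G| = (2 ^ (m * 2))%N).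
Hypotheses (cardH : #|H| = (2 ^ (m * 3))%N) (char2 : 2 \in [pchar K]).

Let char2G : 2 \in [pchar G]. Proof. by rewrite (fmorph_pchar iota2). Qed.
Let char2H : 2 \in [pchar H]. Proof. by rewrite (fmorph_pchar iota3). Qed.
Let fr (x : H) := x ^+ (2 ^ m).
Let fr3 x : fr (fr (fr x)) = x.
Proof.
rewrite /fr -!exprM -!expnD; have -> : (m + (m + m) = m * 3)%N by clear; lia.
by rewrite -cardH expf_card.
Qed.
Let frI a : fr (iota3 a) = iota3 a.
Proof. by rewrite /fr -cardK -rmorphXn expf_card. Qed.
Let frI2 a : iota2 a ^+ (2 ^ m) = iota2 a.
Proof. by rewrite -cardK -rmorphXn expf_card. Qed.
Let frD x y : fr (x + y) = fr x + fr y. Proof. exact: frobD. Qed.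
Let frM x y : fr (x * y) = fr x * fr y. Proof. exact: exprMn. Qed.

Notation tr2 := (tr2 iota2 m).
Notation nm2 := (nm2 iota2 m).
Definition tr3 (x : H) : K :=
  retract iota3 (x + x ^+ (2 ^ m) + x ^+ (2 ^ m) ^+ (2 ^ m)).
(** The second elementary symmetric function of the conjugates. *)
Definition mid3 (x : H) : K := let y := x ^+ (2 ^ m) in let z := y ^+ (2 ^ m) in
  retract iota3 (x * y + y * z + z * x).
Definition nm3 (x : H) : K :=
  retract iota3 (x * x ^+ (2 ^ m) * x ^+ (2 ^ m) ^+ (2 ^ m)).

Lemma tr3E x : iota3 (tr3 x) = x + x ^+ (2 ^ m) + x ^+ (2 ^ m) ^+ (2 ^ m).
Proof. by rewrite retractK // cardK -!/(fr _) !frD fr3; ring. Qed.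

Lemma mid3E x : let y := x ^+ (2 ^ m) in let z := y ^+ (2 ^ m) in
  iota3 (mid3 x) = x * y + y * z + z * x.
Proof. by rewrite /= retractK // cardK -!/(fr _) !(frD, frM) fr3; ring. Qed.

Lemma nm3E x : iota3 (nm3 x) = x * x ^+ (2 ^ m) * x ^+ (2 ^ m) ^+ (2 ^ m).
Proof. by rewrite retractK // cardK -!/(fr _) !frM fr3; ring. Qed.

(** The coefficients of (T - a) times the characteristic polynomial of y, for a
    pair (a, y): up to signs, the three elementary symmetric functions of a, y and
    the conjugate of y. *)
Definition mixed_coefs (p : K * G) : K * K * K :=
  (p.1 + tr2 p.2, p.1 * tr2 p.2 + nm2 p.2, p.1 * nm2 p.2).

Section Fibre.
Variables t e w : K.

Let A := [set x : H | (tr3 x, mid3 x, nm3 x) == (t, e, w)].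
Let C := [set p : K * G | mixed_coefs p == (t, e, w)].
Let Z := [set a : K | a ^+ 3 - t * a ^+ 2 + e * a - w == 0].

Let splitA x z : x \in A ->
  z ^+ 3 - iota3 t * z ^+ 2 + iota3 e * z - iota3 w
  = (z - x) * (z - fr x) * (z - fr (fr x)).
Proof.
rewrite inE => /eqP[<- <- <-]; rewrite tr3E mid3E nm3E -!/(fr _); ring.
Qed.

Let splitC a y z : (a, y) \in C ->
  z ^+ 3 - iota2 t * z ^+ 2 + iota2 e * z - iota2 w
  = (z - iota2 a) * (z - y) * (z - y ^+ (2 ^ m)).
Proof.
rewrite inE /= => /eqP[<- <- <-]; rewrite !(rmorphD, rmorphM) /= tr2E // nm2E //; ring.
Qed.

Let rootC a y : (a, y) \in C -> a \in Z.
Proof.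
move=> /(splitC (iota2 a)); rewrite subrr !mul0r => pa0; rewrite inE.
by rewrite -(fmorph_eq0 iota2) !(rmorphD, rmorphB, rmorphN, rmorphM, rmorphXn) /= pa0.
Qed.

Let le3 (T : finType) (x y z : T) (B : {set T}) :
  B \subset [set x; y; z] -> (#|B| <= 3)%N.
Proof.
move=> /subset_leq_card/leq_trans; apply.
apply: leq_trans (leq_card_setU _ _) _; rewrite cards1 cards2.
by case: eqP.
Qed.

Lemma cubic_count_noroot : Z = set0 -> (#|A| + #|C| + #|Z| <= 3)%N.
Proof.
move=> Z0; have -> : C = set0.
  by apply/setP=> -[a y]; rewrite in_set0; apply/negP => /rootC; rewrite Z0 inE.
rewrite Z0 !cards0 !addn0; have [->|[x xA]] := set_0Vmem A; first by rewrite cards0.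
apply: (@le3 _ x (fr x) (fr (fr x))); apply/subsetP => y yA; rewrite !inE.
rewrite -subr_eq0 -[y == fr x]subr_eq0 -[y == fr (fr x)]subr_eq0 -!mulf_eq0.
by rewrite -(splitA _ xA) (splitA _ yA) subrr !mul0r.
Qed.

(** Once there is a root a in K, the remaining quadratic factor decides.  If it is
    irreducible, only the two pairs (a, y) contribute besides the root; if it splits, a
    pair (a, y) or an element of H requires a double, respectively a triple, root. *)
Lemma cubic_count_root a : a \in Z -> (#|A| + #|C| + #|Z| <= 3)%N.
Proof.
move=> aZ; pose t' := t - a; pose w' := e - a * t'.
have tE : t = a + t' by rewrite /t'; ring.
have eE : e = a * t' + w' by rewrite /w'; ring.
have wE : w = a * w'.
  apply/eqP; rewrite eq_sym -subr_eq0; move: aZ; rewrite inE => /eqP <-.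
  by rewrite /w' /t'; apply/eqP; ring.
have splitZ b : (b \in Z) = (b == a) || (b ^+ 2 - t' * b + w' == 0).
  rewrite inE -[b == a]subr_eq0 -mulf_eq0; congr (_ == 0).
  by rewrite tE eE wE; ring.
have Asub x : x \in A -> [/\ x = iota3 a, t' = 0 & w' = a ^+ 2].
  move=> xA; have xE : x = iota3 a.
    have := splitA (iota3 a) xA.
    have -> : iota3 a ^+ 3 - iota3 t * iota3 a ^+ 2 + iota3 e * iota3 a - iota3 w = 0.
      by rewrite tE eE wE !(rmorphD, rmorphM); ring.
    move/esym/eqP; rewrite !mulf_eq0 !subr_eq0 => /orP[/orP[]|] /eqP aE //.
      by rewrite -[x]fr3 -aE !frI.
    by rewrite -[x]fr3 -aE frI.
  split=> //; move: xA; rewrite inE => /eqP[]; first last.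
    move=> /(congr1 iota3); rewrite tr3E xE -!/(fr _) !frI => tE'.
    move=> /(congr1 iota3); rewrite mid3E -!/(fr _) !frI => eE' _.
    apply: (fmorph_inj iota3); rewrite /w' /t' !(rmorphB, rmorphM, rmorphXn) /= -tE' -eE'.
    by ring.
  move=> /(congr1 iota3); rewrite tr3E xE -!/(fr _) !frI tE => tE' _ _.
  apply: (fmorph_inj iota3); rewrite rmorph0 -(addrr_pchar2 char2H (iota3 a)).
  by rewrite -[LHS](addKr (iota3 a)) -rmorphD -tE'; ring.
have [/eqP Z'0|[b]] := set_0Vmem [set b | b ^+ 2 - t' * b + w' == 0].
  (* The remaining factor is irreducible. *)
  have Za : Z = [set a].
    apply/setP => b; rewrite splitZ inE; move/eqP/setP: Z'0 => /(_ b).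
    by rewrite !inE => ->; rewrite orbF.
  have -> : A = set0.
    apply/eqP; rewrite -subset0; apply/subsetP => x /Asub[_ t'0 w'E].
    move/eqP/setP: Z'0 => /(_ a); rewrite !inE t'0 w'E mul0r subr0.
    by rewrite (addrr_pchar2 char2) eqxx.
  rewrite cards0 Za cards1 add0n addn1 ltnS.
  have := quadratic_count iota2 cardK cardG char2 t' w'.
  rewrite (eqP Z'0) cards0 addn0 => <-.
  have inj_pair : injective (fun y : G => (a, y)) by move=> y z [].
  rewrite -(card_imset _ inj_pair); apply/subset_leq_card/subsetP => -[b y] bC.
  have := rootC bC; rewrite Za inE => /eqP ba; rewrite ba in bC *.
  apply: imset_f; rewrite inE; move: bC; rewrite inE tE eE => /eqP[].
  move=> /addrI -> /addrI -> _; exact: eqxx.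
rewrite inE => /eqP bE; pose c := t' - b.
have w'E : w' = b * c.
  by apply/eqP; rewrite /c -subr_eq0 -bE; apply/eqP; ring.
have t'E : t' = b + c by rewrite /c; ring.
have Zsub : Z \subset [set a; b; c].
  apply/subsetP => z; rewrite splitZ !inE -orbA => /orP[->//|/eqP zE].
  rewrite -[z == b]subr_eq0 -[z == c]subr_eq0 -mulf_eq0 orbC.
  by apply/orP; left; rewrite -zE w'E t'E; apply/eqP; ring.
(* All roots are in K, so that y equals its conjugate: its trace vanishes and d = t. *)
have Csub d y : (d, y) \in C -> exists r, [/\ d = t, y = iota2 r & e = r ^+ 2].
  move=> dC; have yK : y \in codom iota2.
    have := splitC y dC; rewrite subrr mulr0 mul0r.
    have -> : y ^+ 3 - iota2 t * y ^+ 2 + iota2 e * y - iota2 w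
      = (y - iota2 a) * (y - iota2 b) * (y - iota2 c).
      by rewrite tE eE wE w'E t'E !(rmorphD, rmorphM); ring.
    move/eqP; rewrite !mulf_eq0 !subr_eq0 => /orP[/orP[]|] /eqP ->; exact: codom_f.
  have /codomP[r yE] := yK; exists r.
  have tr0 : tr2 y = 0.
    by apply: (fmorph_inj iota2); rewrite tr2E // yE frI2 (addrr_pchar2 char2G) rmorph0.
  have nmr : nm2 y = r ^+ 2.
    by apply: (fmorph_inj iota2); rewrite nm2E // yE frI2 rmorphXn expr2.
  by move: dC; rewrite inE /mixed_coefs /= tr0 nmr addr0 mulr0 add0r => /eqP[-> ->].
have C_le1 : (#|C| <= 1)%N.
  apply/card_le1_eqP => -[d y] [d' y'] /Csub[r [-> -> er]] /Csub[r' [-> -> er']].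
  congr (_, iota2 _); apply: (frob_inj char2 (i := 1)) => /=.
  by rewrite expn1 -er.
have A_le1 : (#|A| <= 1)%N.
  by apply/card_le1_eqP => x y /Asub[-> _ _] /Asub[-> _ _].
have [A0|[x xA]] := set_0Vmem A.
  rewrite A0 cards0 add0n; have [C0|[[d y] dC]] := set_0Vmem C.
    by rewrite C0 cards0 add0n (le3 Zsub).
  apply: (leq_add (n1 := 1) (n2 := 2) C_le1); have dZ := rootC dC.
  have [r [dt _ er]] := Csub _ _ dC; rewrite dt inE in dZ.
  have wt : w = e * t by apply/eqP; rewrite -subr_eq0 -oppr_eq0 -(eqP dZ); apply/eqP; ring.
  have Zsub2 : Z \subset [set t; r].
    apply/subsetP => z; rewrite !inE -[z == t]subr_eq0 -[z == r]subr_eq0.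
    rewrite -[z - r == 0](expf_eq0 _ 2) -mulf_eq0 -[2%N]/(2 ^ 1)%N.
    rewrite -[X in (z - X)](oppr_pchar2 char2) opprK frobD // -er wt.
    by move=> /eqP zE; rewrite -zE; apply/eqP; ring.
  apply: leq_trans (subset_leq_card Zsub2) _.
  by rewrite cards2; case: eqP.
apply: (leq_add (n1 := 2) (n2 := 1)); first exact: (leq_add (n1 := 1) (n2 := 1)).
have [_ t0 w0] := Asub _ xA.
rewrite -(cards1 a); apply/subset_leq_card/subsetP => z; rewrite splitZ inE.
rewrite t0 w0 mul0r subr0 -[2%N]/(2 ^ 1)%N -frobD // expf_eq0 addr_eq0 (oppr_pchar2 char2).
by case/orP.
Qed.

End Fibre.

(** Among the polynomials with all coefficients prescribed, the three terms detect
    respectively the irreducible cubics, the products of a linear and a quadratic factor,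
    and the roots in K.  Each has as total over all (t, e, w) the third power of the order
    of K. *)
Lemma cubic_count t e w :
  (#|[set x : H | (tr3 x, mid3 x, nm3 x) == (t, e, w)]|
   + #|[set p : K * G | mixed_coefs p == (t, e, w)]|
   + #|[set a : K | (a ^+ 3 - t * a ^+ 2 + e * a - w == 0)%R]| = 3)%N.
Proof.
pose roots (p : K * K * K) :=
  [set a : K | a ^+ 3 - p.1.1 * a ^+ 2 + p.1.2 * a - p.2 == 0].
pose f p := (#|[set x : H | (tr3 x, mid3 x, nm3 x) == p]| + #|[set i | mixed_coefs i == p]|
   + #|roots p|)%N.
rewrite -[LHS]/(f (t, e, w)); apply: bounded_sum_tight => [[[t1 e1] w1]|].
  have [/cubic_count_noroot //|[a aZ]] := set_0Vmem (roots (t1, e1, w1)).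
  exact: cubic_count_root aZ.
rewrite !big_split /= !sum_card_fibers.
have rootsE p : #|roots p| = #|[set i : K * K * K |
    (i.1.2, i.2, i.1.1 ^+ 3 - i.1.2 * i.1.1 ^+ 2 + i.2 * i.1.1) == p]|.
  case: p => -[t1 e1] w1; have inj_pair : injective (fun a : K => (a, t1, e1)) by move=> a b [].
  rewrite -(card_imset _ inj_pair).
  apply: eq_card => -[[a t'] e']; rewrite inE.
  apply/imsetP/idP => /= [[b]|/eqP[<- <- <-]].
    by rewrite inE /= subr_eq0 => /eqP b0 [-> -> ->]; rewrite b0.
  by exists a => //; rewrite inE /= subrr.
under eq_bigr do rewrite rootsE.
rewrite sum_card_fibers cardH !card_prod cardG cardK !expnM.
by rewrite -[(_ ^ 3)%N]/((2 ^ m) * ((2 ^ m) * (2 ^ m)))%N -[(_ ^ 2)%N]/((2 ^ m) * (2 ^ m))%N; nia.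
Qed.

End Cubic.

(** * Sums over the fibres of the norm *)

Lemma sum_over_fibre (I J : finType) (K : eqType) (g : I -> J * K) (h : J -> rat) (w : K) :
  \sum_(i | (g i).2 == w) h (g i).1 = \sum_j h j *+ #|[set i | g i == (j, w)]|.
Proof.
rewrite (partition_big (fun i => (g i).1) predT) //=; apply: eq_bigr => j _.
rewrite -sumr_const; apply: eq_big => [i|i /andP[_ /eqP->]] //.
by rewrite inE; case: (g i) => a b /=; rewrite xpair_eqE andbC.
Qed.

Section NormTraceSums.
Variables (K G H : finFieldType).
Variables (iota2 : {rmorphism K -> G}) (iota3 : {rmorphism K -> H}) (m : nat).
Hypotheses (cardK : #|K| = (2 ^ m)%N) (cardG : #|G| = (2 ^ (m * 2))%N).
Hypotheses (cardH : #|H| = (2 ^ (m * 3))%N) (char2 : 2 \in [pchar K]).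
Variable (h : K -> rat).

Notation tr2 := (tr2 iota2 m).
Notation nm2 := (nm2 iota2 m).
Notation tr3 := (tr3 iota3 m).
Notation nm3 := (nm3 iota3 m).

(** The quadratic Davenport-Hasse relation, for an arbitrary function of the trace:
    h an additive character gives a Gauss sum relation, h = 1 the size of the fibres of the
    norm. *)
Lemma norm_trace_sum2 w : w != 0 ->
  \sum_(x : G | nm2 x == w) h (tr2 x)
  = 2 * (\sum_t h t) - \sum_(a | a != 0) h (a + w / a).
Proof.
move=> w_neq0; rewrite (sum_over_fibre (fun x : G => (tr2 x, nm2 x))).
apply: (canRL (addrK _)); rewrite mulr_sumr.
have -> : \sum_(a | a != 0) h (a + w / a)
    = \sum_t h t *+ #|[set a : K | a ^+ 2 - t * a + w == 0]|.
  rewrite [RHS](eq_bigr (fun t => \sum_(a | a ^+ 2 - t * a + w == 0) h t)); last first.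
    by move=> t _; rewrite -sumr_const; apply: eq_bigl => a; rewrite inE.
  rewrite [RHS](exchange_big_dep predT) //= [RHS](bigID (fun a : K => a == 0)) /=.
  rewrite big_pred1_eq /= [X in _ = X + _]big_pred0 ?add0r; last first.
    by move=> t; rewrite expr0n mulr0 subr0 add0r (negPf w_neq0).
  apply: eq_bigr => a a_neq0; rewrite (big_pred1 (a + w / a)) // => t /=.
  have -> : a ^+ 2 - t * a + w = - a * (t - (a + w / a)) by field.
  by rewrite mulf_eq0 oppr_eq0 (negPf a_neq0) subr_eq0.
rewrite -big_split; apply: eq_bigr => t _ /=.
by rewrite -mulrnDr (quadratic_count iota2 cardK cardG char2) mulr2n; ring.
Qed.

(** The cubic analogue, one step of a recursion: the roots in K contribute a multiple
    of the sum of h, because for a given nonzero root and trace exactly one middle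
    coefficient gives the norm w. *)
Lemma norm_trace_sum3 w : w != 0 ->
  \sum_(x : H | nm3 x == w) h (tr3 x)
  = 2 * #|K|%:R * (\sum_t h t) + \sum_t h t
    - \sum_(a | a != 0) \sum_(y : G | nm2 y == w / a) h (a + tr2 y).
Proof.
move=> w_neq0; pose h1 (p : K * K) := h p.1.
rewrite (sum_over_fibre (fun x : H => ((tr3 x, mid3 iota3 m x), nm3 x)) h1).
have mixedE : \sum_(a | a != 0) \sum_(y : G | nm2 y == w / a) h (a + tr2 y)
    = \sum_(p : K * K) h1 p *+ #|[set i | mixed_coefs iota2 m i == (p, w)]|.
  rewrite -(sum_over_fibre (mixed_coefs iota2 m) h1) pair_big_dep /=.
  apply: eq_bigl => -[a y] /=.
  case: eqP => [->|/eqP a_neq0] /=; first by rewrite mul0r eq_sym (negPf w_neq0).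
  by rewrite -(inj_eq (mulfI a_neq0)) [a * (w / a)]mulrC divfK.
have rootE : \sum_(p : K * K) h1 p *+ #|[set a : K | a ^+ 3 - p.1 * a ^+ 2 + p.2 * a - w == 0]|
    = (#|K|%:R - 1) * \sum_t h t.
  rewrite (eq_bigr (fun p : K * K =>
     \sum_(a | a ^+ 3 - p.1 * a ^+ 2 + p.2 * a - w == 0) h p.1)); last first.
    by move=> t _; rewrite -sumr_const; apply: eq_bigl => a; rewrite inE.
  rewrite (exchange_big_dep predT) //= (bigID (fun a : K => a == 0)) /=.
  rewrite big_pred1_eq /= big_pred0 ?add0r; last first.
    by move=> p; rewrite !expr0n !mulr0 subr0 !add0r oppr_eq0 (negPf w_neq0).
  rewrite (eq_bigr (fun _ => \sum_t h t)) => [|a a_neq0].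
    rewrite sumr_const (cardC1 (0 : K)) -[_ *+ _]mulr_natl -subn1 natrB //.
    by rewrite cardK expn_gt0.
  pose e_ t := w / a - a ^+ 2 + t * a.
  rewrite -(pair_big_dep predT (fun t e => a ^+ 3 - t * a ^+ 2 + e * a - w == 0)
    (fun t _ => h t)) /=.
  apply: eq_bigr => t _; rewrite (big_pred1 (e_ t)) // => e /=.
  have -> : a ^+ 3 - t * a ^+ 2 + e * a - w = a * (e - e_ t) by rewrite /e_; field.
  by rewrite mulf_eq0 (negPf a_neq0) subr_eq0.
apply: (canRL (addrK _)); rewrite mixedE; apply: (addIr ((#|K|%:R - 1) * \sum_t h t)).
rewrite -[in LHS]rootE -!big_split /=.
rewrite (eq_bigr (fun p : K * K => 3 * h p.1)) => [|[t e] _].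
  rewrite -mulr_sumr -(pair_big_dep predT (fun _ _ => true) (fun t _ => h t)) /=.
  rewrite (eq_bigr (fun t => #|K|%:R * h t)) => [|t _]; last by rewrite sumr_const mulr_natl.
  by rewrite -mulr_sumr; ring.
by rewrite -!mulrnDr (cubic_count iota2 iota3 cardK cardG cardH char2) mulr_natl.
Qed.

End NormTraceSums.

(** * The conic and its lines *)

Section Conic.
Variables (K : finFieldType) (s : nat).
Hypotheses (char2 : 2 \in [pchar K]) (cardK : #|K| = (2 ^ (s * 3))%N).
Hypotheses (cardE : #|frob_fixed K s| = (2 ^ s)%N).

Notation q := (2 ^ s)%N.
Notation E := (frob_fixed K s).

(** The trace from K to its subfield of order q, with q^3 the order of K. *)
Definition conj_trace (x : K) : K := x + x ^+ q + x ^+ q ^+ q.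

(** Points of the projective plane are represented by all their vectors, so that each
    point of the conic on the line of coefficient w is counted q - 1 times. *)
Definition conic_line (w : K) : {set K} :=
  [set u | [&& u != 0, conj_trace (u ^+ (1 + q)) == 0 & conj_trace (w * u) == 0]].

Let fr (x : K) := x ^+ q.
Let fr3 x : fr (fr (fr x)) = x.
Proof.
rewrite /fr -!exprM -!expnD; have -> : (s + (s + s) = s * 3)%N by clear; lia.
by rewrite -cardK expf_card.
Qed.
Let frD x y : fr (x + y) = fr x + fr y. Proof. exact: frobD. Qed.
Let frM x y : fr (x * y) = fr x * fr y. Proof. exact: exprMn. Qed.
Let frV x : fr x^-1 = (fr x)^-1. Proof. exact: exprVn. Qed.
Let fr_neq0 x : x != 0 -> fr x != 0. Proof. exact: expf_neq0. Qed.
Let frE x : (x \in E) = (fr x == x). Proof. by rewrite inE. Qed.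

Lemma conj_traceZ c x : c \in E -> conj_trace (c * x) = c * conj_trace x.
Proof.
rewrite frE => /eqP c_fix; rewrite /conj_trace -!/(fr _) !frM !c_fix; ring.
Qed.

Lemma conj_trace_sqr x : conj_trace (x ^+ 2) = conj_trace x ^+ 2.
Proof.
by rewrite /conj_trace -[RHS]/(_ ^+ (2 ^ 1)) !frobD // expn1 ![_ ^+ 2 ^+ _]exprAC.
Qed.

Lemma conj_trace_fix x : conj_trace x \in E.
Proof. by rewrite frE /conj_trace -!/(fr _) !frD fr3; apply/eqP; ring. Qed.

Lemma conj_trace_id x : x \in E -> conj_trace x = x.
Proof.
rewrite frE => /eqP x_fix; rewrite /conj_trace -!/(fr _) !x_fix.
by rewrite (addrr_pchar2 char2) add0r.
Qed.

(** Inversion exchanges the conic and the line of trace 0. *)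
Lemma conj_trace_inv u : u != 0 -> (conj_trace (u ^+ (1 + q)) == 0) = (conj_trace u^-1 == 0).
Proof.
move=> u_neq0; have u1 := fr_neq0 u_neq0; have u2 := fr_neq0 u1.
have -> : conj_trace (u ^+ (1 + q)) = u * fr u * fr (fr u) * conj_trace u^-1.
  rewrite /conj_trace exprD expr1 -!/(fr _) !frM fr3 !frV.
  by field; rewrite u_neq0 u1 u2.
by rewrite !mulf_eq0 (negPf u_neq0) (negPf u1) (negPf u2).
Qed.

Lemma conic_lineE w u :
  (u \in conic_line w) = [&& u != 0, conj_trace u^-1 == 0 & conj_trace (w * u) == 0].
Proof.
by rewrite inE; have [->|u_neq0] /= := eqVneq u 0; rewrite ?eqxx ?conj_trace_inv.
Qed.

Lemma conic_lineZ c w : c \in E -> c != 0 -> conic_line (c * w) = conic_line w.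
Proof.
move=> cE c_neq0; apply/setP => u; rewrite !inE -mulrA conj_traceZ //.
by rewrite mulf_eq0 (negPf c_neq0).
Qed.

Lemma conic_line_scale c w u : c \in E -> c != 0 -> u \in conic_line w ->
  c * u \in conic_line w.
Proof.
move=> cE c_neq0; rewrite !conic_lineE => /and3P[u_neq0 /eqP u1 /eqP wu].
rewrite mulf_neq0 //= invfM mulrCA (conj_traceZ _ cE) (conj_traceZ _ (frob_fixedV cE)).
by rewrite u1 wu !mulr0 eqxx.
Qed.

(** Eliminating the third conjugate of u between the equations of the line and of
    the conic leaves a binary quadratic equation in u and u^q. *)
Lemma conic_line_quadratic w u : u \in conic_line w ->
  w * u ^+ 2 + fr w * fr u ^+ 2 = conj_trace w * (u * fr u).
Proof.
rewrite conic_lineE => /and3P[u_neq0 /eqP u_inv /eqP wu].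
have u1 := fr_neq0 u_neq0; have u2 := fr_neq0 u1.
have e2 : u * fr u + fr u * fr (fr u) + fr (fr u) * u = 0.
  have -> : u * fr u + fr u * fr (fr u) + fr (fr u) * u
      = u * fr u * fr (fr u) * conj_trace u^-1.
    by rewrite /conj_trace -!/(fr _) !frV; field; rewrite u_neq0 u1 u2.
  by rewrite u_inv mulr0.
have lin : w * u + fr w * fr u + fr (fr w) * fr (fr u) = 0.
  by move: wu; rewrite /conj_trace -!/(fr _) !frM.
apply/eqP; rewrite -subr_eq0.
have -> : w * u ^+ 2 + fr w * fr u ^+ 2 - conj_trace w * (u * fr u)
   = (w * u + fr w * fr u + fr (fr w) * fr (fr u)) * (u + fr u)
     - fr (fr w) * (u * fr u + fr u * fr (fr u) + fr (fr u) * u)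
     - (w + fr w) * (u * fr u + u * fr u).
  by rewrite /conj_trace -!/(fr _); ring.
by rewrite lin e2 (addrr_pchar2 char2) mul0r !mulr0 !subr0.
Qed.

Let Es := [set x in E | x != 0].
Let cardEs : #|Es| = (q - 1)%N.
Proof.
rewrite -cardE (cardsD1 0 E) inE expr0n expn_eq0 eqxx add1n subn1 /=.
by apply: eq_card => x; rewrite !inE andbC.
Qed.

(** For a line through the nucleus the quadratic equation says that w u^2 is
    fixed by Frobenius.  Squaring being bijective, this leaves one point. *)
Lemma card_conic_line_tangent w : w != 0 -> conj_trace w = 0 ->
  #|conic_line w| = (q - 1)%N.
Proof.
move=> w_neq0 tr0; pose f u : K := u ^+ 2 * w.
have f_inj : injective f.
  by move=> u v /(mulIf w_neq0); apply: (frob_inj char2 (i := 1)).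
rewrite -cardEs -(card_preimset Es f_inj); apply: eq_card => u.
have -> : (u \in f @^-1: Es) = (fr (f u) == f u) && (u != 0).
  by rewrite !inE mulf_eq0 (negPf w_neq0) orbF expf_eq0.
apply/idP/andP => [uS|[fix_f u_neq0]].
  have := conic_line_quadratic uS; rewrite tr0 mul0r.
  move/eqP; rewrite addr_eq0 (oppr_pchar2 char2) => /eqP wu2.
  move: uS; rewrite inE => /and3P[-> _ _]; split=> //.
  have -> : fr (f u) = fr w * fr u ^+ 2 by rewrite /f expr2 !frM; ring.
  by rewrite -wu2 mulrC.
have fE : f u \in E by rewrite frE.
have w_eq : w = f u * u ^- 2 by rewrite /f; field.
have trV : conj_trace u^-1 = 0.
  suff : conj_trace u^-1 ^+ 2 == 0 by rewrite expf_eq0 => /eqP.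
  move/eqP: tr0; rewrite {1}w_eq conj_traceZ // -exprVn conj_trace_sqr mulf_eq0.
  by rewrite /f mulf_eq0 (negPf w_neq0) expf_eq0 (negPf u_neq0).
rewrite conic_lineE u_neq0 trV eqxx /=.
have -> : w * u = f u * u^-1 by rewrite {1}w_eq; field.
by rewrite conj_traceZ // trV mulr0.
Qed.

(** The map u -> 1/(u w) exchanges the two conditions Tr(1/u) = 0 and
    Tr(w u) = 0. *)
Lemma conic_line_inv w u : w != 0 -> u \in conic_line w -> (u * w)^-1 \in conic_line w.
Proof.
move=> w_neq0; rewrite !conic_lineE invrK => /and3P[u_neq0 u_inv wu].
rewrite invr_neq0 ?mulf_neq0 //= mulrC wu /=.
by have -> : w * (w * u)^-1 = u^-1 by field; rewrite u_neq0 w_neq0.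
Qed.

(** The binary quadratic equation has at most two solutions u^(q-1), and they are
    exchanged by u -> 1/(u w). *)
Lemma card_conic_line_secant w u : w != 0 -> conj_trace w != 0 -> u \in conic_line w ->
  #|conic_line w| = (2 * (q - 1))%N.
Proof.
move=> w_neq0 tr_neq0 uS; pose u' := (u * w)^-1.
have u'S : u' \in conic_line w by exact: conic_line_inv.
have u_neq0 : u != 0 by move: uS; rewrite inE => /and3P[].
have u'_neq0 : u' != 0 by move: u'S; rewrite inE => /and3P[].
have w1 := fr_neq0 w_neq0; have u1 := fr_neq0 u_neq0.
pose cone x := [set c * x | c in Es].
have card_cone x : x != 0 -> #|cone x| = (q - 1)%N.
  by move=> x_neq0; rewrite card_imset //; apply: mulIf.
have mem_cone x v : x != 0 -> v != 0 -> fr v * x = v * fr x -> v \in cone x.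
  move=> x_neq0 v_neq0 vx; have x1 := fr_neq0 x_neq0.
  apply/imsetP; exists (v / x); last by rewrite divfK.
  rewrite 2!inE -/(fr _) frM frV mulf_neq0 ?invr_neq0 // andbT.
  by rewrite eqr_div // vx.
have -> : conic_line w = cone u :|: cone u'.
  apply/setP => v; rewrite in_setU; apply/idP/orP => [vS|[]/imsetP[c]]; first last.
  - by rewrite 1!inE => /andP[cE c_neq0 ->]; exact: conic_line_scale.
  - by rewrite 1!inE => /andP[cE c_neq0 ->]; exact: conic_line_scale.
  have v_neq0 : v != 0 by move: vS; rewrite inE => /and3P[].
  have := conic_line_quadratic vS; have := conic_line_quadratic uS => qu qv.
  (* The two factors say that v is proportional to u, respectively to 1 / (u w). *)
  have : (fr v * u - v * fr u) * (fr v * (fr u * fr w) - v * (u * w)) = 0.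
    have -> : (fr v * u - v * fr u) * (fr v * (fr u * fr w) - v * (u * w))
      = u * fr u * (w * v ^+ 2 + fr w * fr v ^+ 2)
        - v * fr v * (w * u ^+ 2 + fr w * fr u ^+ 2) by ring.
    by rewrite qu qv; ring.
  move/eqP; rewrite mulf_eq0 !subr_eq0 => /orP[]/eqP vE; [left|right]; apply: mem_cone => //.
  apply/eqP; rewrite /u' frV frM eqr_div ?mulf_neq0 //; exact/eqP.
have dis : cone u :&: cone u' = set0.
  apply/eqP; rewrite -subset0; apply/subsetP => v; rewrite inE => /andP[].
  move=> /imsetP[c]; rewrite 1!inE => /andP[cE c_neq0 ->].
  move=> /imsetP[d]; rewrite 1!inE => /andP[dE d_neq0] cd.
  (* A point fixed by the involution makes the left side of the quadratic equation vanish. *)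
  have uwE : w * u ^+ 2 \in E.
    have -> : w * u ^+ 2 = d / c.
      apply/eqP; rewrite -(inj_eq (mulfI c_neq0)) [c * (d / c)]mulrC divfK //.
      have -> : c * (w * u ^+ 2) = (c * u) * (u * w) by ring.
      by rewrite cd /u' divfK // mulf_neq0.
    by rewrite frob_fixedM ?frob_fixedV.
  have := conic_line_quadratic uS.
  have -> : fr w * fr u ^+ 2 = fr (w * u ^+ 2) by rewrite !expr2 !frM.
  move: uwE; rewrite frE => /eqP ->.
  rewrite (addrr_pchar2 char2) => /esym/eqP.
  by rewrite !mulf_eq0 (negPf tr_neq0) (negPf u_neq0) (negPf u1).
by rewrite cardsU dis cards0 subn0 !card_cone // mul2n addnn.
Qed.

End Conic.

(** * Multiplicative convolution with the additive character *)

Section Calculus.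
Variables (K : finFieldType) (s : nat).
Hypotheses (s_gt0 : (0 < s)%N).
Hypotheses (char2 : 2 \in [pchar K]) (cardK : #|K| = (2 ^ (s * 3))%N).
Hypotheses (cardE : #|frob_fixed K s| = (2 ^ s)%N).

Notation E := (frob_fixed K s).
Notation psi := (add_char (s * 3)%N).
Notation tr := (conj_trace s).
Notation q := ((2 ^ s)%:R : rat).

Let fixK (x : K) : x \in frob_fixed K (s * 3).
Proof. by rewrite inE -cardK expf_card. Qed.

Let q_gt1 : 1 < q.
Proof. by rewrite ltr1n -(expn0 2) ltn_exp2l. Qed.

Let cardKq : #|K|%:R = q ^+ 3.
Proof. by rewrite cardK expnM natrX. Qed.

Lemma psiD (x y : K) : psi (x + y) = psi x * psi y.
Proof. exact: add_charD. Qed.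

Lemma sum_psi (b : K) : \sum_x psi (x * b) = if b == 0 then q ^+ 3 else 0.
Proof.
by rewrite (sum_add_char_full char2 b _ cardK) ?muln_gt0 ?s_gt0 // cardKq.
Qed.

Lemma sum_psi_neq0 (b : K) :
  \sum_(x | x != 0) psi (x * b) = (if b == 0 then q ^+ 3 else 0) - 1.
Proof.
rewrite -sum_psi [in RHS](bigD1 (0 : K)) //= mul0r add_char0.
by rewrite addrAC subrr add0r.
Qed.

Lemma sum_psi_sub (v : K) :
  \sum_(x in E | x != 0) psi (x * v) = q * (tr v == 0)%:R - 1.
Proof.
have psi_tr (x : K) : psi x = add_char s (tr x).
  rewrite /add_char (abs_trace_tower char2) !big_ord_recr big_ord0 /= add0r.
  by rewrite muln0 expr1 muln1 muln2 -addnn expnD exprM.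
transitivity (\sum_(x in E) add_char s (x * tr v) - 1).
  have E0 : (0 : K) \in E by rewrite inE expr0n expn_eq0.
  rewrite [in RHS](bigD1 (0 : K)) //= mul0r add_char0 addrAC subrr add0r.
  by apply: eq_bigr => x /andP[xE _]; rewrite psi_tr conj_traceZ.
rewrite (sum_add_char char2 s_gt0 cardE (conj_trace_fix char2 cardK v)).
by case: (_ == _); rewrite ?mulr1 ?mulr0.
Qed.

Lemma sum_subfield_neq0 : \sum_(x in E | x != 0) 1 = q - 1 :> rat.
Proof.
rewrite -cardE -sum1_card natr_sum [in RHS](bigD1 (0 : K)) ?inE ?expr0n ?expn_eq0 //=.
by rewrite addrAC subrr add0r.
Qed.

Lemma reindex_scale (c : K) (f : K -> rat) : c != 0 ->
  \sum_(x | x != 0) f x = \sum_(x | x != 0) f (c * x).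
Proof.
move=> c_neq0; rewrite (reindex_inj (mulfI c_neq0)) /=.
by apply: eq_bigl => x; rewrite mulf_eq0 (negPf c_neq0).
Qed.

Lemma reindex_inv (f : K -> rat) :
  \sum_(x | x != 0) f x = \sum_(x | x != 0) f x^-1.
Proof.
by rewrite (reindex_inj invr_inj) /=; apply: eq_bigl => x; rewrite invr_eq0.
Qed.

Lemma sum_one_neq0 : \sum_(x : K | x != 0) 1 = q ^+ 3 - 1 :> rat.
Proof.
rewrite sumr_const (cardC1 (0 : K)) -[_ *+ _]mulr_natl mulr1 -subn1 natrB ?cardKq //.
by rewrite cardK expn_gt0.
Qed.

(** The convolution over the multiplicative group of K. *)
Definition mconv (f g : K -> rat) (v : K) : rat := \sum_(a | a != 0) f a * g (v / a).
Notation W := (mconv psi).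

Definition fourier (f : K -> rat) (v : K) : rat :=
  \sum_(x | x != 0) psi (v * x) * f x.

Lemma eq_fourier f g v : (forall x, x != 0 -> f x = g x) -> fourier f v = fourier g v.
Proof. by move=> fg; apply: eq_bigr => x /fg ->. Qed.

Lemma fourier_lin f g x y z v : v != 0 ->
  fourier (fun u => x * f u + y * g u + z) v = x * fourier f v + y * fourier g v - z.
Proof.
move=> v_neq0; have zE : \sum_(a | a != 0) psi (v * a) * z = - z.
  rewrite -mulr_suml; under eq_bigr do rewrite mulrC.
  by rewrite sum_psi_neq0 (negPf v_neq0); ring.
rewrite -[- z]zE !mulr_sumr -!big_split /=.
by apply: eq_bigr => a _; ring.
Qed.

(** Convolution by an additive character is the Fourier transform after inversion. *)
Lemma mconv_fourier f v : v != 0 -> W f v = fourier (fun x => f x^-1) v.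
Proof.
move=> v_neq0; rewrite /mconv (reindex_scale _ v_neq0); apply: eq_bigr => x x_neq0.
by congr (_ * f _); field; rewrite x_neq0 v_neq0.
Qed.

Lemma eq_mconv f g v : (forall x, x != 0 -> f x = g x) -> v != 0 -> W f v = W g v.
Proof.
move=> fg v_neq0; rewrite !mconv_fourier //; apply: eq_fourier => x x_neq0.
by rewrite fg ?invr_eq0.
Qed.

Lemma mconv_lin f g x y z v : v != 0 ->
  W (fun u => x * f u + y * g u + z) v = x * W f v + y * W g v - z.
Proof. by move=> v_neq0; rewrite !mconv_fourier // fourier_lin. Qed.

Lemma sum_mconv f : \sum_(v | v != 0) W f v = - \sum_(v | v != 0) f v.
Proof.
rewrite exchange_big /= -mulN1r.
have <- : \sum_(a : K | a != 0) psi a = -1.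
  rewrite (eq_bigr (fun a => psi (a * 1))) => [|a _]; last by rewrite mulr1.
  by rewrite sum_psi_neq0 oner_eq0 sub0r.
rewrite mulr_suml; apply: eq_bigr => a a_neq0.
rewrite -mulr_sumr (reindex_scale f (c := a^-1)) ?invr_eq0 //.
by congr (_ * _); apply: eq_bigr => v _; rewrite mulrC.
Qed.

(** Fourier inversion on the multiplicative group; the subtracted sum accounts for the
    missing element 0. *)
Lemma fourierK f v : v != 0 ->
  fourier (fourier f) v = q ^+ 3 * f v - \sum_(x | x != 0) f x.
Proof.
move=> v_neq0; rewrite /fourier; under eq_bigr do rewrite mulr_sumr.
rewrite exchange_big /=.
transitivity (\sum_(x | x != 0) ((if x == v then q ^+ 3 * f x else 0) - f x)).
  apply: eq_bigr => x x_neq0.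
  transitivity ((\sum_(u | u != 0) psi (u * (v + x))) * f x).
    rewrite mulr_suml; apply: eq_bigr => u _.
    by rewrite mulrDr psiD [v * u]mulrC mulrA.
  rewrite sum_psi_neq0 [v + x]addrC addr_eq0 (oppr_pchar2 char2).
  by case: eqP => _; ring.
rewrite big_split sumrN -big_mkcondr (big_pred1 v) // => x /=.
by rewrite andbC; case: eqP => // ->.
Qed.

Definition in_E (v : K) : rat := (v \in E)%:R.
(** The indicator of trace 0, that is, of the tangent lines. *)
Definition tau (v : K) : rat := (tr v == 0)%:R.
(** The indicator of the conic. *)
Definition kappa (v : K) : rat := tau v^-1.
(** The number of projective points of the conic on the line of coefficient v. *)
Definition points (v : K) : rat := #|conic_line s v|%:R / (q - 1).

Let in_EV v : in_E v^-1 = in_E v.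
Proof.
by rewrite /in_E; congr (nat_of_bool _)%:R; apply/idP/idP => /frob_fixedV; rewrite ?invrK.
Qed.

Lemma fourier_in_E v : fourier in_E v = q * tau v - 1.
Proof.
rewrite -sum_psi_sub /fourier big_mkcondl.
rewrite [RHS]big_mkcond [LHS]big_mkcond.
apply: eq_bigr => x _; rewrite /in_E; case: eqP => //= _.
by case: (x \in E); rewrite ?mulr1 ?mulr0 // mulrC.
Qed.

Lemma mconv_in_E v : v != 0 -> W in_E v = q * tau v - 1.
Proof.
by move=> v_neq0; rewrite mconv_fourier // -fourier_in_E; apply: eq_fourier => x _; exact: in_EV.
Qed.

Lemma sum_in_E : \sum_(v | v != 0) in_E v = q - 1.
Proof.
rewrite -sum_subfield_neq0 big_mkcondl; apply: eq_bigr => x _.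
by rewrite /in_E; case: (_ \in _).
Qed.

Lemma sum_tau : \sum_(v | v != 0) tau v = q ^+ 2 - 1.
Proof.
have := sum_mconv in_E; rewrite sum_in_E.
rewrite (eq_bigr (fun v => q * tau v - 1)) => [|v]; last exact: mconv_in_E.
rewrite big_split sumrN -mulr_sumr sum_one_neq0 /= => eq_sum.
apply: (mulfI (x := q)); first by rewrite gt_eqF // (lt_trans ltr01).
by rewrite (canRL (subrK _) eq_sum); ring.
Qed.

Lemma sum_kappa : \sum_(v | v != 0) kappa v = q ^+ 2 - 1.
Proof. by rewrite -sum_tau reindex_inv; apply: eq_bigr => x _; rewrite /kappa invrK. Qed.

Let q_neq0 : q != 0. Proof. by rewrite gt_eqF // (lt_trans ltr01). Qed.
Let q1_neq0 : q - 1 != 0. Proof. by rewrite gt_eqF // subr_gt0. Qed.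

(** The hyperplane of trace 0 is the orthogonal of E for the pairing
    psi(x y), so its transform is that of E, inverted. *)
Lemma mconv_kappa v : v != 0 -> W kappa v = q ^+ 2 * in_E v - 1.
Proof.
move=> v_neq0; rewrite mconv_fourier //.
have tauE x : kappa x^-1 = q^-1 * fourier in_E x + 0 * in_E x + q^-1.
  by rewrite /kappa invrK fourier_in_E; field.
rewrite (eq_fourier v (fun x _ => tauE x)) fourier_lin // fourierK // sum_in_E.
by field.
Qed.

(** The conic is stable under scaling by E, so that its transform at v can be averaged
    over the scalars; the average counts the conic points on the line of coefficient v. *)
Lemma mconv_tau v : v != 0 -> W tau v = q * points v - (q + 1).
Proof.
move=> v_neq0; rewrite mconv_fourier //.
apply: (mulfI q1_neq0).
(* Average over the scalars in E. *)
transitivity (\sum_(l in E | l != 0) fourier kappa v).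
  by rewrite -sum_subfield_neq0 mulr_suml; under eq_bigr do rewrite mul1r.
rewrite (eq_bigr (fun l => \sum_(x | x != 0) psi (l * (v * x)) * kappa x)) => [|l /andP[lE l_neq0]].
  rewrite exchange_big /=.
  rewrite (eq_bigr (fun x => (q * (tau (v * x) * kappa x) - kappa x))) => [|x _].
    rewrite big_split sumrN -mulr_sumr sum_kappa /= /points.
    suff -> : \sum_(x | x != 0) tau (v * x) * kappa x = #|conic_line s v|%:R by field.
    rewrite -sum1_card natr_sum [RHS]big_mkcond [LHS]big_mkcond.
    apply: eq_bigr => x _; rewrite conic_lineE // /kappa /tau.
    by case: eqP => // _; case: eqP; case: eqP; rewrite ?mulr0 ?mul0r ?mulr1.
  by rewrite -mulr_suml sum_psi_sub /tau; ring.
rewrite /fourier (reindex_scale _ l_neq0); apply: eq_bigr => x x_neq0.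
rewrite mulrCA; congr (_ * _); rewrite /kappa /tau invfM conj_traceZ ?frob_fixedV //.
by rewrite mulf_eq0 invr_eq0 (negPf l_neq0).
Qed.

(** Since the number of points on a line is, up to constants, the transform of the
    conic, its own transform gives back the conic. *)
Lemma mconv_points_inv v : v != 0 ->
  W (fun x => points x^-1) v = q ^+ 2 * kappa v - (q + 1).
Proof.
move=> v_neq0; rewrite mconv_fourier //.
have pE x : x != 0 ->
    points x^-1^-1 = q^-1 * fourier kappa x + 0 * kappa x + (q + 1) / q.
  by rewrite invrK => /[dup] x_neq0 /mconv_tau; rewrite mconv_fourier // /kappa => ->; field.
rewrite (eq_fourier v pE) fourier_lin // fourierK // sum_kappa.
by field.
Qed.

Lemma sum_points : \sum_(v | v != 0) points v = (q ^+ 2 - 1) * (q + 1).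
Proof.
have := sum_mconv tau; rewrite sum_tau.
rewrite (eq_bigr (fun v => q * points v - (q + 1) * 1)) => [|v]; last by move/mconv_tau->; rewrite mulr1.
rewrite big_split sumrN -!mulr_sumr sum_one_neq0 /= => eq_sum.
by apply: (mulfI q_neq0); rewrite (canRL (subrK _) eq_sum); ring.
Qed.

Definition tangent (v : K) : rat := (#|conic_line s v| == 2 ^ s - 1)%N%:R.
Definition secant (v : K) : rat := (#|conic_line s v| == 2 * (2 ^ s - 1))%N%:R.

(** The bridge from geometry: tangents, and only they, have trace 0, and a secant
    has two points. *)
Lemma tau_points v : v != 0 ->
  tau v = tangent v /\ points v = tangent v + 2 * secant v.
Proof.
move=> v_neq0; rewrite /tau /tangent /secant /points.
have q1_gt0 : (0 < 2 ^ s - 1)%N by rewrite subn_gt0 -(expn0 2) ltn_exp2l.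
have q1E : (2 ^ s - 1)%:R = q - 1 by rewrite natrB ?expn_gt0.
have [tr0|/eqP tr_neq0] := tr v =P 0.
  rewrite (card_conic_line_tangent char2 cardK cardE v_neq0 tr0) eqxx q1E divff //.
  by have -> : (2 ^ s - 1 == 2 * (2 ^ s - 1))%N = false by lia; split=> //; ring.
have [->|[u uS]] := set_0Vmem (conic_line s v).
  rewrite cards0 mul0r; have -> : (0 == 2 ^ s - 1)%N = false by lia.
  by have -> : (0 == 2 * (2 ^ s - 1))%N = false by lia; split=> //; ring.
rewrite (card_conic_line_secant char2 cardK cardE v_neq0 tr_neq0 uS) eqxx natrM q1E.
have -> : (2 * (2 ^ s - 1) == 2 ^ s - 1)%N = false by lia.
by split=> //; rewrite mulfK //; ring.
Qed.

Notation tangent_inv := (fun x => tangent x^-1).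
Notation secant_inv := (fun x => secant x^-1).

Lemma mconv_tangent_inv v : v != 0 -> W tangent_inv v = q ^+ 2 * in_E v - 1.
Proof.
move=> v_neq0; rewrite -mconv_kappa //; apply: eq_mconv => // x x_neq0.
by rewrite /kappa; have [->] := tau_points (invr_neq0 x_neq0).
Qed.

Lemma mconv_secant_inv v : v != 0 ->
  W secant_inv v = q ^+ 2 / 2 * kappa v + - q ^+ 2 / 2 * in_E v + - q / 2.
Proof.
move=> v_neq0.
have sE x : x != 0 ->
    secant x^-1 = 1 / 2 * (fun y => points y^-1) x + - 1 / 2 * tangent_inv x + 0.
  by move=> x_neq0 /=; have [_ ->] := tau_points (invr_neq0 x_neq0); field.
by rewrite (eq_mconv sE) // mconv_lin // mconv_points_inv // mconv_tangent_inv //; field.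
Qed.

Lemma mconv2_tangent_inv v : v != 0 ->
  W (W tangent_inv) v = q ^+ 3 * tau v + 0 * tau v + (1 - q ^+ 2).
Proof.
move=> v_neq0.
have fE x : x != 0 -> W tangent_inv x = q ^+ 2 * in_E x + 0 * in_E x + - 1.
  by move/mconv_tangent_inv->; ring.
by rewrite (eq_mconv fE) // mconv_lin // mconv_in_E //; ring.
Qed.

Lemma mconv2_secant_inv v : v != 0 ->
  W (W secant_inv) v = q ^+ 4 / 2 * in_E v + - q ^+ 3 / 2 * tau v + q / 2.
Proof.
move=> v_neq0; rewrite (eq_mconv mconv_secant_inv) // mconv_lin //.
by rewrite mconv_in_E // mconv_kappa //; field.
Qed.

Lemma mconv3_tangent_inv v : v != 0 ->
  W (W (W tangent_inv)) v
  = q ^+ 4 * (tangent v + 2 * secant v) - q ^+ 3 * (q + 1) + q ^+ 2 - 1.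
Proof.
move=> v_neq0; rewrite (eq_mconv mconv2_tangent_inv) // mconv_lin // mconv_tau //.
by have [_ ->] := tau_points v_neq0; ring.
Qed.

Lemma mconv3_secant_inv v : v != 0 ->
  W (W (W secant_inv)) v
  = q ^+ 4 / 2 * (q * tangent v - 1)
    - q ^+ 3 / 2 * (q * (tangent v + 2 * secant v) - (q + 1)) - q / 2.
Proof.
move=> v_neq0; rewrite (eq_mconv mconv2_secant_inv) // mconv_lin // mconv_tau //.
rewrite mconv_in_E //.
by have [-> ->] := tau_points v_neq0; ring.
Qed.

Lemma sum_tangent : \sum_(v | v != 0) tangent v = q ^+ 2 - 1.
Proof. by rewrite -sum_tau; apply: eq_bigr => v /tau_points[->]. Qed.

Lemma sum_secant : \sum_(v | v != 0) secant v = (q ^+ 2 - 1) * q / 2.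
Proof.
have := sum_points; rewrite (eq_bigr (fun v => tangent v + 2 * secant v)) => [|v].
  by rewrite big_split -mulr_sumr sum_tangent /= => /(canRL (addKr _)) E2; lra.
by move/tau_points => [_ ->].
Qed.

End Calculus.

(** * Translation schemes and their eigenvalues *)

Section TranslationScheme.
Variables (d : nat) (X : finFieldType) (cl : X -> 'I_d.+1).
Hypotheses (cl0 : forall x, (cl x == ord0) = (x == 0)) (clN : forall x, cl (- x) = cl x).
Hypothesis cl_surj : forall i, exists x, cl x = i.
Variable (D : 'I_d.+1 -> {set X}).
Hypothesis DE : forall i x, (x \in D i) = (cl x == i).

Lemma mem_translation_rel i x y : ((x, y) \in translation_rel D i) = (cl (y - x) == i).
Proof.
apply/imset2P/eqP => [[x' z' _]|<-].
  by rewrite DE => /eqP <- [-> ->]; rewrite addrC addKr.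
by exists x (y - x); rewrite ?inE ?DE ?eqxx // addrC subrK.
Qed.

(** The entry (a, b) of the product counts the z in D i with b - a - z in D j, a function
    of b - a alone. *)
Lemma translation_rel_mulmx i j (p : 'I_d.+1 -> rat) :
    (forall z, #|[set x in D i | z - x \in D j]|%:R = p (cl z)) ->
  adj_mx (translation_rel D i) *m adj_mx (translation_rel D j)
  = \sum_k p k *: adj_mx (translation_rel D k).
Proof.
move=> conv; apply/matrixP => a b; rewrite mxE summxE.
transitivity (p (cl (enum_val b - enum_val a))).
  rewrite -conv -sum1_card natr_sum.
  rewrite (reindex (fun c => enum_rank (enum_val a + c))) /=; last first.
    exists (fun c => enum_val c - enum_val a) => c _.
      by rewrite enum_rankK addrAC subrr add0r.
    by rewrite addrC subrK enum_valK.
  rewrite big_mkcond [RHS]big_mkcond; apply: eq_bigr => c _.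
  rewrite !mxE !enum_rankK !mem_translation_rel inE !DE.
  rewrite [_ + c - _]addrAC subrr add0r opprD addrA.
  by case: (cl c == i); case: (_ == j); rewrite ?mulr1 ?mulr0 ?mul0r.
rewrite (bigD1 (cl (enum_val b - enum_val a))) //= big1 => [|k neq_k].
  by rewrite !mxE mem_translation_rel eqxx mulr1 addr0.
by rewrite !mxE mem_translation_rel eq_sym (negPf neq_k) mulr0.
Qed.

Lemma translation_association_scheme (B : 'I_d.+1 -> 'M[rat]_d.+1) :
    (forall i j z, #|[set x in D i | z - x \in D j]|%:R = B i (cl z) j) ->
  association_scheme (translation_rel D)
  /\ forall i, intersection_matrix (translation_rel D) i (B i).
Proof.
move=> conv.
have inter i : intersection_matrix (translation_rel D) i (B i).
  by move=> j; apply: (translation_rel_mulmx (p := fun k => B i k j)) => z; apply: conv.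
split=> //; split; last by exists (fun i j k => B i k j) => i j; apply: inter.
- have Rinj : injective (translation_rel D).
    move=> i j eq_ij; have [x clx] := cl_surj i.
    have : (0, x) \in translation_rel D i by rewrite mem_translation_rel subr0 clx.
    by rewrite eq_ij mem_translation_rel subr0 clx => /eqP.
  split=> //; apply/and3P; split.
  + apply/eqP/setP => -[x y]; rewrite inE; apply/bigcupP.
    exists (translation_rel D (cl (y - x))); first exact: imset_f.
    by rewrite mem_translation_rel.
  + apply/trivIsetP => _ _ /imsetP[i _ ->] /imsetP[j _ ->] neq_ij.
    apply/pred0P => -[x y] /=; rewrite !mem_translation_rel.
    apply/negbTE; apply: contra neq_ij => /andP[/eqP <- /eqP <-]; exact: eqxx.
  + apply/imsetP => -[i _ Ri]; have [x clx] := cl_surj i.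
    have : (0, x) \in translation_rel D i by rewrite mem_translation_rel subr0 clx.
    by rewrite -Ri inE.
- apply/setP => -[x y]; rewrite mem_translation_rel cl0 subr_eq0.
  by apply/eqP/imsetP => [->|[z _ [-> ->]]//]; exists x.
- by move=> i x y; rewrite !mem_translation_rel -opprB clN.
Qed.

End TranslationScheme.

Section CharacterCriterion.
Variables (d : nat) (X : finFieldType) (D : 'I_d.+1 -> {set X}) (cl : X -> 'I_d.+1).
Hypothesis DE : forall i x, (x \in D i) = (cl x == i).
Variable (chi : X -> rat).
Hypothesis chiD : forall x y, chi (x + y) = chi x * chi y.
Hypothesis sum_chi : forall y, \sum_x chi (x * y) = if y == 0 then #|X|%:R else 0.

(** The characters chi(x y), for y in X, form a complete orthogonal family. *)
Lemma fourier_injective (f g : X -> rat) :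
    (forall y, \sum_x f x * chi (x * y) = \sum_x g x * chi (x * y)) ->
  forall z, f z = g z.
Proof.
move=> eq_fg z.
have inv (h : X -> rat) :
    \sum_y (\sum_x h x * chi (x * y)) * chi (y * (- z)) = h z * #|X|%:R.
  transitivity (\sum_x h x * \sum_y chi (y * (x - z))).
    under eq_bigr do rewrite mulr_suml.
    rewrite exchange_big; apply: eq_bigr => x _; rewrite mulr_sumr.
    by apply: eq_bigr => y _; rewrite -mulrA -chiD; congr (_ * chi _); ring.
  rewrite (bigD1 z) //= [X in _ + X]big1 ?addr0 => [|x neq_xz]; rewrite sum_chi subr_eq0.
    by rewrite eqxx.
  by rewrite (negPf neq_xz) mulr0.
have cardX : #|X|%:R != 0 :> rat by rewrite pnatr_eq0 -lt0n (ltn_trans _ (finNzRing_gt1 X)).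
apply: (mulIf cardX); rewrite -!inv; apply: eq_bigr => y _; congr (_ * _).
exact: eq_fg.
Qed.

Definition eigenvalue i y := \sum_(x in D i) chi (x * y).

(** The transform of a convolution is the product of the transforms. *)
Lemma convolution_of_eigenvalues i j (p : 'I_d.+1 -> rat) :
    (forall y, eigenvalue i y * eigenvalue j y = \sum_k p k * eigenvalue k y) ->
  forall z, #|[set x in D i | z - x \in D j]|%:R = p (cl z).
Proof.
move=> eig; apply: fourier_injective => y.
transitivity (eigenvalue i y * eigenvalue j y).
  rewrite (eq_bigr (fun z => \sum_(x in D i) (z - x \in D j)%:R * chi (z * y))); last first.
    move=> z _; rewrite -sum1_card natr_sum mulr_suml big_mkcond [RHS]big_mkcond.
    by apply: eq_bigr => x _; rewrite inE; case: (x \in _); case: (_ \in _); rewrite ?mul0r.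
  rewrite exchange_big mulr_suml; apply: eq_bigr => x _.
  rewrite (reindex_inj (addrI x)) mulr_sumr [RHS]big_mkcond; apply: eq_bigr => u _ /=.
  rewrite [_ + u - _]addrAC subrr add0r mulrDl chiD.
  by case: (u \in D j); rewrite ?mul1r ?mul0r.
rewrite eig; under eq_bigr do rewrite mulr_sumr.
rewrite (exchange_big_dep predT) //=; apply: eq_bigr => x _.
by under eq_bigl do rewrite DE eq_sym; rewrite big_pred1_eq.
Qed.

End CharacterCriterion.

(** * The polynomial identities between eigenvalues and intersection numbers *)

Definition scheme_mx (B1 B2 B3 : 'M[rat]_4) (i : 'I_4) : 'M[rat]_4 :=
  tnth [tuple 1%:M; B1; B2; B3] i.

(** The eigenvalues of the four classes at one character; the diagonal class always has
    eigenvalue 1. *)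
Definition eigenrow (a1 a2 a3 : rat) (i : 'I_4) : rat := [:: 1; a1; a2; a3]`_i.

(** The values e_i(y) at a fixed y define a character of the algebra whose structure
    constants are the matrices B. *)
Definition is_eigenrow (B : 'I_4 -> 'M[rat]_4) (a : 'I_4 -> rat) :=
  forall i j, a i * a j = \sum_k B i k j * a k.

Ltac eigenrow_tac :=
  move=> [[|[|[|[|//]]]] ?] [[|[|[|[|//]]]] ?];
  rewrite !big_ord_recl big_ord0 /scheme_mx !(tnth_nth 0) /= ?mxE /eigenrow /=; by field.

(** The row at y = 0 consists of the valencies. *)
Lemma eigenrow_G0 q : is_eigenrow (scheme_mx (BG1 q) (BG2 q) (BG3 q))
  (eigenrow ((q ^+ 3 + 1) * (q ^+ 2 - 1)) ((q ^+ 3 + 1) * ((q ^+ 2 - 1) * q / 2))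
     ((q ^+ 3 + 1) * (q * (q - 1) ^+ 2 / 2))).
Proof. eigenrow_tac. Qed.

(** Here n and t stand for the indicators of E and of trace 0 at the norm of y; they
    exclude one another because Tr(v) = 3 v = v on E. *)
Lemma eigenrow_G q n t : (n, t) \in [:: (1, 0); (0, 1); (0, 0)] ->
  let a1 := - (q ^+ 3 * t + 1 - q ^+ 2) in
  let a2 := - (q ^+ 4 / 2 * n - q ^+ 3 / 2 * t + q / 2) in
  is_eigenrow (scheme_mx (BG1 q) (BG2 q) (BG3 q)) (eigenrow a1 a2 (- 1 - a1 - a2)).
Proof. by rewrite !inE => /or3P[] /eqP[-> ->] /=; eigenrow_tac. Qed.

Lemma eigenrow_H0 q : is_eigenrow (scheme_mx (BH1 q) (BH2 q) (BH3 q))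
  (eigenrow ((q ^+ 6 + q ^+ 3 + 1) * (q ^+ 2 - 1))
     ((q ^+ 6 + q ^+ 3 + 1) * ((q ^+ 2 - 1) * q / 2))
     ((q ^+ 6 + q ^+ 3 + 1) * (q * (q - 1) ^+ 2 / 2))).
Proof. eigenrow_tac. Qed.

(** Here t and r stand for the indicators of tangent and secant lines at the norm
    of y. *)
Lemma eigenrow_H q t r : (t, r) \in [:: (1, 0); (0, 1); (0, 0)] ->
  let a1 := q ^+ 4 * (t + 2 * r) - q ^+ 3 * (q + 1) + q ^+ 2 - 1 in
  let a2 := q ^+ 4 / 2 * (q * t - 1) - q ^+ 3 / 2 * (q * (t + 2 * r) - (q + 1)) - q / 2 in
  is_eigenrow (scheme_mx (BH1 q) (BH2 q) (BH3 q)) (eigenrow a1 a2 (- 1 - a1 - a2)).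
Proof. by rewrite !inE => /or3P[] /eqP[-> ->] /=; eigenrow_tac. Qed.

(** * Schemes defined by the norm to the field of order q^3 *)

(** Associativity, by the substitution w = a b. *)
Lemma mconvA (K : finFieldType) (f g h : K -> rat) v :
  mconv (mconv f g) h v = mconv f (mconv g h) v.
Proof.
rewrite /mconv; under eq_bigr do rewrite mulr_suml.
under [RHS]eq_bigr do rewrite mulr_sumr.
rewrite exchange_big; apply: eq_bigr => a a_neq0.
rewrite (reindex_scale _ a_neq0); apply: eq_bigr => b b_neq0.
rewrite -mulrA; congr (_ * (g _ * h _)); first by rewrite mulrC mulKf.
by rewrite invfM mulrA.
Qed.

Notation o0 := (@Ordinal 4 0 isT).
Notation o1 := (@Ordinal 4 1 isT).
Notation o2 := (@Ordinal 4 2 isT).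
Notation o3 := (@Ordinal 4 3 isT).

Lemma sum_ord4 (f : 'I_4 -> rat) : \sum_i f i = f o0 + f o1 + f o2 + f o3.
Proof.
rewrite !big_ord_recl big_ord0 addr0 !addrA.
by congr (f _ + f _ + f _ + f _); apply/val_inj.
Qed.

Section NormScheme.
Variables (K L : finFieldType) (s : nat).
Hypotheses (s_gt0 : (0 < s)%N).
Hypotheses (char2 : 2 \in [pchar K]) (cardK : #|K| = (2 ^ (s * 3))%N).
Hypotheses (cardE : #|frob_fixed K s| = (2 ^ s)%N).
Notation q := ((2 ^ s)%:R : rat).

(** The value 0 is kept for the zero vector, which is the coefficient of no line. *)
Definition line_class (w : K) : 'I_4 :=
  if w == 0 then o0 else
  if #|conic_line s w| == (2 ^ s - 1)%N then o1 else
  if #|conic_line s w| == (2 * (2 ^ s - 1))%N then o2 else o3.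

Variables (N T : L -> K).
Hypotheses (NM : {morph N : x y / x * y}) (N_eq0 : forall x, (N x == 0) = (x == 0)).
Hypothesis TD : {morph T : x y / x + y}.

Variable D : 'I_4 -> {set L}.
Hypothesis DE : forall i x, (x \in D i) = (line_class (N x) == i).

Notation chi := (fun x => add_char (s * 3)%N (T x)).
Hypothesis sum_chi : forall y, \sum_x chi (x * y) = if y == 0 then #|L|%:R else 0.
Variable fibre : rat.
Hypothesis fibreE : forall w, w != 0 -> \sum_(x : L | N x == w) 1 = fibre.

(** A Gauss-type sum: the additive character of L summed over a fibre of the
    norm. *)
Definition fibre_sum (w : K) : rat := \sum_(x | N x == w) chi x.

Let neq0 x : x != 0 -> N x != 0. Proof. by rewrite N_eq0. Qed.

Lemma norm_invariant_sum0 f :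
  \sum_(x | x != 0) f (N x) = fibre * \sum_(w | w != 0) f w.
Proof.
rewrite (partition_big N (fun w => w != 0)) => [|x]; last by rewrite N_eq0.
rewrite mulr_sumr; apply: eq_bigr => w w_neq0.
rewrite -(fibreE w_neq0) mulr_suml; apply: eq_big => [x|x /andP[_ /eqP->]].
  by rewrite -N_eq0; case: (N x =P w) => [->|_]; rewrite ?andbF ?w_neq0.
by rewrite mul1r.
Qed.

(** Substitute z = x y and sort the z by their norm. *)
Lemma norm_invariant_fourier f y : y != 0 ->
  \sum_(x | x != 0) f (N x) * chi (x * y)
  = mconv fibre_sum (fun w => f w^-1) (N y).
Proof.
move=> y_neq0; rewrite /mconv.
rewrite (reindex_inj (mulIf (invr_neq0 y_neq0))) /=.
rewrite (partition_big N (fun w => w != 0)) /=; last first.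
  by move=> x; rewrite N_eq0 mulf_eq0 negb_or => /andP[].
apply: eq_bigr => w w_neq0; rewrite /fibre_sum mulr_suml.
apply: eq_big => [x|x /andP[_ /eqP Nx]].
  rewrite mulf_eq0 invr_eq0 (negPf y_neq0) orbF -N_eq0.
  by case: (N x =P w) => [->|_]; rewrite ?andbF ?w_neq0.
rewrite divfK // mulrC; congr (_ * f _).
rewrite invf_div -Nx; apply: (mulIf (neq0 y_neq0)).
by rewrite -NM !divfK // neq0.
Qed.

Let e := eigenvalue D chi.

Let mem_D i x : (x \in D i) = (line_class (N x) == i).
Proof. exact: DE. Qed.

Let T0 : T 0 = 0.
Proof. by apply: (addrI (T 0)); rewrite -TD !addr0. Qed.

Lemma eigenvalue_0 y : e o0 y = 1.
Proof.
rewrite /e /eigenvalue (big_pred1 0) => [|x /=].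
  by rewrite mul0r T0 add_char0.
rewrite mem_D /line_class N_eq0; case: (x =P 0) => //= _.
by case: ifP => // _; case: ifP.
Qed.

Lemma eigenvalue_1 y : e o1 y
  = \sum_(x | x != 0) tangent s (N x) * chi (x * y).
Proof.
rewrite /e /eigenvalue big_mkcond [RHS]big_mkcond; apply: eq_bigr => x _.
rewrite mem_D /line_class N_eq0 /tangent; case: (x =P 0) => //= _.
case: (_ == (2 ^ s - 1)%N); first by rewrite mul1r.
by rewrite mul0r; case: (_ == (2 * (2 ^ s - 1))%N).
Qed.

Lemma eigenvalue_2 y : e o2 y
  = \sum_(x | x != 0) secant s (N x) * chi (x * y).
Proof.
have q1_gt0 : (0 < 2 ^ s - 1)%N by rewrite subn_gt0 -(expn0 2) ltn_exp2l.
rewrite /e /eigenvalue big_mkcond [RHS]big_mkcond; apply: eq_bigr => x _.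
rewrite mem_D /line_class N_eq0 /secant; case: (x =P 0) => //= _.
case: (_ =P (2 ^ s - 1)%N) => [->|_]; last first.
  by case: (_ == (2 * (2 ^ s - 1))%N); rewrite ?mul1r ?mul0r.
have -> : (2 ^ s - 1 == 2 * (2 ^ s - 1))%N = false by clear -q1_gt0; lia.
by rewrite mul0r.
Qed.

Lemma sum_eigenvalues y :
  \sum_i e i y = if y == 0 then #|L|%:R else 0.
Proof.
rewrite -sum_chi (partition_big (fun x => line_class (N x)) predT) //=.
by apply: eq_bigr => i _; apply: eq_bigl => x; rewrite mem_D.
Qed.

Hypothesis char2L : 2 \in [pchar L].

Lemma norm_scheme (B : 'I_4 -> 'M[rat]_4) :
    (forall y i j, e i y * e j y = \sum_k B i k j * e k y) ->
    (forall i, e i 0 != 0) ->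
  association_scheme (translation_rel D)
  /\ forall i, intersection_matrix (translation_rel D) i (B i).
Proof.
move=> eig e_neq0.
have chiD x y : chi (x + y) = chi x * chi y by rewrite TD (psiD char2 cardK).
apply: (translation_association_scheme (cl := fun x => line_class (N x))).
- move=> x; rewrite -N_eq0 /line_class; case: (N x =P 0) => // _.
  by case: (_ == (2 ^ s - 1)%N) => //; case: (_ == (2 * (2 ^ s - 1))%N).
- by move=> x; rewrite (oppr_pchar2 char2L).
- move=> i; have [D0|[x]] := set_0Vmem (D i); last by rewrite DE => /eqP; exists x.
  by have := e_neq0 i; rewrite /e /eigenvalue D0 big_set0 eqxx.
- exact: DE.
move=> i j; pose p k := B i k j.
by apply: (convolution_of_eigenvalues DE chiD sum_chi (p := p)) => y; apply: eig.
Qed.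

Hypothesis fibre_gt0 : 0 < fibre.

Let e1 y := e o1 y.
Let e2 y := e o2 y.

Lemma eigenvaluesE y i :
  e i y = eigenrow (e1 y) (e2 y) ((if y == 0 then #|L|%:R else 0) - 1 - e1 y - e2 y) i.
Proof.
have := sum_eigenvalues y; rewrite sum_ord4.
rewrite eigenvalue_0 => sum_e.
case: i => [[|[|[|[|//]]]] lti]; rewrite /eigenrow /=.
- by rewrite -(eigenvalue_0 y); congr (e _ _); apply/val_inj.
- by congr (e _ _); apply/val_inj.
- by congr (e _ _); apply/val_inj.
rewrite -sum_e /e1 /e2; have -> : Ordinal lti = o3 by apply/val_inj.
by ring.
Qed.

(** Every class is nonempty because its eigenvalue at 0, its cardinality, is a
    product of positive factors. *)
Lemma norm_scheme_of_rows (B : 'I_4 -> 'M[rat]_4) :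
    is_eigenrow B (eigenrow (fibre * (q ^+ 2 - 1)) (fibre * ((q ^+ 2 - 1) * q / 2))
                     (fibre * (q * (q - 1) ^+ 2 / 2))) ->
    (forall v, v != 0 -> let a1 := mconv fibre_sum (fun w => tangent s w^-1) v in
       let a2 := mconv fibre_sum (fun w => secant s w^-1) v in
       is_eigenrow B (eigenrow a1 a2 (-1 - a1 - a2))) ->
  association_scheme (translation_rel D)
  /\ forall i, intersection_matrix (translation_rel D) i (B i).
Proof.
move=> row0 row.
have cardL : #|L|%:R = fibre * (q ^+ 3 - 1) + 1.
  have := norm_invariant_sum0 (fun _ => 1); rewrite (sum_one_neq0 cardK) => <-.
  rewrite sumr_const (cardC1 (0 : L)) -[_ *+ _]mulr_natl mulr1.
  by rewrite natr1 prednK // (ltn_trans _ (finNzRing_gt1 L)).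
have e1_0 : e1 0 = fibre * (q ^+ 2 - 1).
  rewrite /e1 eigenvalue_1 -(sum_tangent s_gt0 char2 cardK cardE) -norm_invariant_sum0.
  by apply: eq_bigr => x _; rewrite mulr0 T0 add_char0 mulr1.
have e2_0 : e2 0 = fibre * ((q ^+ 2 - 1) * q / 2).
  rewrite /e2 eigenvalue_2 -(sum_secant s_gt0 char2 cardK cardE) -norm_invariant_sum0.
  by apply: eq_bigr => x _; rewrite mulr0 T0 add_char0 mulr1.
have e0E i : e i 0 = eigenrow (fibre * (q ^+ 2 - 1)) (fibre * ((q ^+ 2 - 1) * q / 2))
                     (fibre * (q * (q - 1) ^+ 2 / 2)) i.
  rewrite eigenvaluesE eqxx e1_0 e2_0 cardL; congr (eigenrow _ _ _ i).
  by field.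
apply: norm_scheme => [y i j|i].
  have [->|y_neq0] := eqVneq y 0; first by under eq_bigr do rewrite e0E; rewrite !e0E; apply: row0.
  under eq_bigr do rewrite eigenvaluesE; rewrite !eigenvaluesE (negPf y_neq0) sub0r.
  have -> : e1 y = mconv fibre_sum (fun w => tangent s w^-1) (N y).
    by rewrite /e1 eigenvalue_1 norm_invariant_fourier.
  have -> : e2 y = mconv fibre_sum (fun w => secant s w^-1) (N y).
    by rewrite /e2 eigenvalue_2 norm_invariant_fourier.
  exact: row (neq0 y_neq0) _ _.
have q_gt1 : 1 < q by rewrite ltr1n -(expn0 2) ltn_exp2l.
have q0 : q != 0 by rewrite gt_eqF // (lt_trans ltr01).
have q1 : q - 1 != 0 by rewrite gt_eqF // subr_gt0.
have q2 : q ^+ 2 - 1 != 0 by rewrite gt_eqF // subr_gt0 exprn_egt1.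
rewrite e0E; case: i => [[|[|[|[|//]]]] lti]; rewrite /eigenrow /=;
by rewrite ?oner_neq0 ?mulf_neq0 ?expf_neq0 ?invr_eq0 // gt_eqF.
Qed.

End NormScheme.

(** * The schemes on the quadratic and on the cubic extension *)

(** Transitivity of the trace, transported to K along [iota]. *)
Lemma add_char_trace (K L : finFieldType) (iota : {rmorphism K -> L}) m n (t : K) (x : L) :
    2 \in [pchar L] -> iota t = \sum_(j < n) x ^+ (2 ^ (m * j)) ->
  add_char (m * n)%N x = add_char m t.
Proof.
move=> char2L tE; rewrite /add_char (abs_trace_tower char2L) -tE.
have -> : abs_trace m (iota t) = iota (abs_trace m t).
  by rewrite /abs_trace rmorph_sum; apply: eq_bigr => i _; rewrite rmorphXn.
by rewrite fmorph_eq0.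
Qed.

Section Schemes.
Variables (K G H : finFieldType) (s : nat).
Variables (iota2 : {rmorphism K -> G}) (iota3 : {rmorphism K -> H}).
Hypotheses (s_gt0 : (0 < s)%N).
Hypotheses (char2 : 2 \in [pchar K]) (cardK : #|K| = (2 ^ (s * 3))%N).
Hypotheses (cardG : #|G| = (2 ^ (s * 3 * 2))%N) (cardH : #|H| = (2 ^ (s * 3 * 3))%N).
Hypotheses (cardE : #|frob_fixed K s| = (2 ^ s)%N).
Notation q := ((2 ^ s)%:R : rat).
Notation m := (s * 3)%N.
Notation psi := (add_char m).
Notation W := (mconv psi).

Let char2G : 2 \in [pchar G]. Proof. by rewrite (fmorph_pchar iota2). Qed.
Let char2H : 2 \in [pchar H]. Proof. by rewrite (fmorph_pchar iota3). Qed.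

Lemma sum_psi0 : \sum_(t : K) psi t = 0.
Proof.
rewrite (eq_bigr (fun t => psi (t * 1))) => [|t _]; last by rewrite mulr1.
by rewrite (sum_psi s_gt0 char2 cardK) oner_eq0.
Qed.

Lemma sum_ones : \sum_(t : K) 1 = q ^+ 3 :> rat.
Proof.
by rewrite -(natr_sum _ _ _ (fun=> 1%N)) sum1_card cardK expnM natrX.
Qed.

Lemma eq_mconvl (f1 f2 g : K -> rat) v :
  (forall a, a != 0 -> f1 a = f2 a) -> mconv f1 g v = mconv f2 g v.
Proof. by move=> f12; apply: eq_bigr => a /f12 ->. Qed.

Lemma mconvNl (f g : K -> rat) v : mconv (fun a => - f a) g v = - mconv f g v.
Proof. by rewrite /mconv -sumrN; apply: eq_bigr => a _; rewrite mulNr. Qed.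

Notation tr2 := (tr2 iota2 m).
Notation nm2 := (nm2 iota2 m).

Lemma nm2M : {morph nm2 : x y / x * y}.
Proof.
move=> x y; apply: (fmorph_inj iota2); rewrite rmorphM !(nm2E iota2 cardK cardG) exprMn; ring.
Qed.

Lemma nm2_eq0 x : (nm2 x == 0) = (x == 0).
Proof.
rewrite -(fmorph_eq0 iota2) (nm2E iota2 cardK cardG) mulf_eq0 expf_eq0 expn_gt0 /=.
by rewrite orbb.
Qed.

Lemma tr2D : {morph tr2 : x y / x + y}.
Proof.
move=> x y; apply: (fmorph_inj iota2).
rewrite rmorphD !(tr2E iota2 cardK cardG char2) (frobD char2G); ring.
Qed.

Lemma sum_chi2 y : \sum_x psi (tr2 (x * y)) = if y == 0 then #|G|%:R else 0.
Proof.
rewrite -(sum_add_char_full char2G y _ cardG) ?muln_gt0 ?s_gt0 //.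
apply: eq_bigr => x _; apply/esym/(add_char_trace (iota := iota2) (n := 2)) => //.
rewrite (tr2E iota2 cardK cardG char2) !big_ord_recr big_ord0 /=.
by rewrite muln0 expr1 muln1 add0r.
Qed.

Lemma fibre2 w : w != 0 -> \sum_(x : G | nm2 x == w) 1 = q ^+ 3 + 1 :> rat.
Proof.
move=> w_neq0; rewrite (norm_trace_sum2 iota2 cardK cardG char2 (fun _ => 1)) //.
by rewrite (sum_one_neq0 cardK) sum_ones; ring.
Qed.

(** The Davenport-Hasse relation for the quadratic extension; the sum of psi over K
    vanishes. *)
Lemma fibre_sum2 w : w != 0 -> fibre_sum s nm2 tr2 w = - W psi w.
Proof.
move=> w_neq0; rewrite /fibre_sum (norm_trace_sum2 iota2 cardK cardG char2 psi) //.
rewrite sum_psi0 mulr0 sub0r; congr (- _); apply: eq_bigr => a _.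
exact: (psiD char2 cardK).
Qed.

(** The three rows of eigenvalues are indexed by the position of the norm of y: in E,
    of trace 0, or neither.  This is another partition than the one into line classes. *)
Lemma quadratic_extension_scheme (D : 'I_4 -> {set G}) :
    (forall i x, (x \in D i) = (line_class s (nm2 x) == i)) ->
  association_scheme (translation_rel D)
  /\ forall i, intersection_matrix (translation_rel D) i
                 (scheme_mx (BG1 q) (BG2 q) (BG3 q) i).
Proof.
move=> DE; apply: (norm_scheme_of_rows s_gt0 char2 cardK cardE nm2M nm2_eq0 tr2D DE
  sum_chi2 fibre2 char2G).
- by rewrite addr_gt0 ?exprn_gt0 // ltr0n expn_gt0.
- exact: eigenrow_G0.
move=> v v_neq0 a1 a2.
have a1E : a1 = - (q ^+ 3 * tangent s v + 1 - q ^+ 2).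
  rewrite /a1 (eq_mconvl _ _ fibre_sum2) mconvNl mconvA.
  rewrite (mconv2_tangent_inv s_gt0 char2 cardK cardE v_neq0).
  by have [-> _] := tau_points s_gt0 char2 cardK cardE v_neq0; field.
have a2E : a2 = - (q ^+ 4 / 2 * in_E s v - q ^+ 3 / 2 * tangent s v + q / 2).
  rewrite /a2 (eq_mconvl _ _ fibre_sum2) mconvNl mconvA.
  rewrite (mconv2_secant_inv s_gt0 char2 cardK cardE v_neq0).
  by have [-> _] := tau_points s_gt0 char2 cardK cardE v_neq0; field.
rewrite a1E a2E; apply: eigenrow_G.
have [<- _] := tau_points s_gt0 char2 cardK cardE v_neq0.
rewrite /in_E /tau; case: (boolP (v \in _)) => [vE|_].
  by rewrite (conj_trace_id char2 vE) (negPf v_neq0).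
by case: (_ == 0).
Qed.

Notation tr3 := (tr3 iota3 m).
Notation nm3 := (nm3 iota3 m).

Lemma nm3M : {morph nm3 : x y / x * y}.
Proof.
move=> x y; apply: (fmorph_inj iota3); rewrite rmorphM !(nm3E iota3 cardK cardH) !exprMn; ring.
Qed.

Lemma nm3_eq0 x : (nm3 x == 0) = (x == 0).
Proof.
rewrite -(fmorph_eq0 iota3) (nm3E iota3 cardK cardH) !mulf_eq0 !expf_eq0 !expn_gt0 /=.
by rewrite !orbb.
Qed.

Lemma tr3D : {morph tr3 : x y / x + y}.
Proof.
move=> x y; apply: (fmorph_inj iota3).
rewrite rmorphD !(tr3E iota3 cardK cardH char2) !(frobD char2H); ring.
Qed.

Lemma sum_chi3 y : \sum_x psi (tr3 (x * y)) = if y == 0 then #|H|%:R else 0.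
Proof.
rewrite -(sum_add_char_full char2H y _ cardH) ?muln_gt0 ?s_gt0 //.
apply: eq_bigr => x _; apply/esym/(add_char_trace (iota := iota3) (n := 3)) => //.
rewrite (tr3E iota3 cardK cardH char2) !big_ord_recr big_ord0 /=.
by rewrite muln0 expr1 muln1 add0r muln2 -addnn expnD exprM.
Qed.

Lemma fibre3 w : w != 0 -> \sum_(x : H | nm3 x == w) 1 = q ^+ 6 + q ^+ 3 + 1 :> rat.
Proof.
move=> w_neq0.
rewrite (norm_trace_sum3 iota2 iota3 cardK cardG cardH char2 (fun _ => 1)) //.
rewrite [X in _ - X](eq_bigr (fun _ => (q ^+ 3 + 1) * 1)) => [|a a_neq0]; last first.
  by rewrite fibre2 ?mulr1 // mulf_neq0 ?invr_eq0.
by rewrite -mulr_sumr (sum_one_neq0 cardK) sum_ones cardK expnM natrX; ring.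
Qed.

(** The Davenport-Hasse relation for the cubic extension, through the quadratic one:
    the pairs (a, y) of norm w give a convolution of psi with [fibre_sum2]. *)
Lemma fibre_sum3 w : w != 0 -> fibre_sum s nm3 tr3 w = W (W psi) w.
Proof.
move=> w_neq0; rewrite /fibre_sum.
rewrite (norm_trace_sum3 iota2 iota3 cardK cardG cardH char2 psi) //.
rewrite sum_psi0 mulr0 !add0r -sumrN; apply: eq_bigr => a a_neq0.
rewrite (eq_bigr (fun y => psi a * psi (tr2 y))) => [|y _]; last exact: (psiD char2 cardK).
rewrite -mulr_sumr -/(fibre_sum s nm2 tr2 (w / a)) fibre_sum2; first by rewrite mulrN opprK.
by rewrite mulf_neq0 ?invr_eq0.
Qed.

(** One more convolution than in the quadratic case makes the eigenvalues at y depend on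
    the line class of the norm of y. *)
Lemma cubic_extension_scheme (D : 'I_4 -> {set H}) :
    (forall i x, (x \in D i) = (line_class s (nm3 x) == i)) ->
  association_scheme (translation_rel D)
  /\ forall i, intersection_matrix (translation_rel D) i
                 (scheme_mx (BH1 q) (BH2 q) (BH3 q) i).
Proof.
move=> DE; apply: (norm_scheme_of_rows s_gt0 char2 cardK cardE nm3M nm3_eq0 tr3D DE
  sum_chi3 fibre3 char2H).
- by rewrite !addr_gt0 ?exprn_gt0 // ltr0n expn_gt0.
- exact: eigenrow_H0.
move=> v v_neq0 a1 a2.
have mconvA3 f : mconv (W (W psi)) f v = W (W (W f)) v.
  by rewrite mconvA; apply: eq_bigr => a _; rewrite mconvA.
have a1E : a1 = q ^+ 4 * (tangent s v + 2 * secant s v) - q ^+ 3 * (q + 1) + q ^+ 2 - 1.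
  rewrite /a1 (eq_mconvl _ _ fibre_sum3) mconvA3.
  exact: (mconv3_tangent_inv s_gt0 char2 cardK cardE v_neq0).
have a2E : a2 = q ^+ 4 / 2 * (q * tangent s v - 1)
    - q ^+ 3 / 2 * (q * (tangent s v + 2 * secant s v) - (q + 1)) - q / 2.
  rewrite /a2 (eq_mconvl _ _ fibre_sum3) mconvA3.
  exact: (mconv3_secant_inv s_gt0 char2 cardK cardE v_neq0).
rewrite a1E a2E; apply: eigenrow_H.
rewrite /tangent /secant.
have [->|_] := eqVneq (#|conic_line s v|) (2 ^ s - 1)%N; last by case: (_ == _).
have q1_gt0 : (0 < 2 ^ s - 1)%N by rewrite subn_gt0 -(expn0 2) ltn_exp2l.
by have -> : (2 ^ s - 1 == 2 * (2 ^ s - 1))%N = false by clear -q1_gt0; lia.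
Qed.

End Schemes.

(** * Relative trace and norm as sums and products of Frobenius powers *)

Lemma big_cycle (gT : finGroupType) (a : gT) (R : Type) (idx : R)
    (op : Monoid.com_law idx) (f : gT -> R) :
  \big[op/idx]_(x in <[a]>%g) f x = \big[op/idx]_(i < #[a]%g) f (a ^+ i)%g.
Proof.
have injX : injective (fun i : 'I_#[a]%g => (a ^+ i)%g).
  move=> i j /eqP; rewrite eq_expg_mod_order !modn_small // => /eqP.
  exact: val_inj.
rewrite -(big_imset f (A := predT)); last by move=> i j _ _ /injX.
apply: eq_bigl => x; apply/idP/imsetP => [/cyclePmin[i lti ->]|[i _ ->]].
  by exists (Ordinal lti).
exact: mem_cycle.
Qed.

Section RelTrace.
Variables (k : finFieldType) (K : fieldExtType k).

Lemma gal_frobenius (n : nat) :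
    #|finvect_type K| = (#|k| ^ n)%N ->
  exists2 alpha : gal_of {:finvect_type K},
    'Gal({:finvect_type K} / 1)%g = <[alpha]>%g /\ #[alpha]%g = n &
    forall i x, (alpha ^+ i)%g x = x ^+ (#|k| ^ i).
Proof.
move=> cardK.
have [alpha gen fr] := finField_galois_generator (sub1v {:finvect_type K}).
have dimK : \dim {:finvect_type K} = n.
  have := etrans (esym (card_vspace {:finvect_type K}%VS)) (card_vspacef _).
  rewrite cardK => /eqP.
  by rewrite eqn_exp2l ?finNzRing_gt1 // => /eqP.
have gg := eqP gen.
exists alpha; first split=> //.
  rewrite orderE -gg -galois_dim; last exact: finField_galois (sub1v _).
  by rewrite dimv1 divn1.
elim=> [|i IH] x; first by rewrite expg0 gal_id expn0 expr1.
rewrite expgSr galM ?memvf // fr ?memvf // IH.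
by rewrite dimv1 expn1 expnSr exprM.
Qed.

Lemma rel_traceE n (x : finvect_type K) :
    #|finvect_type K| = (#|k| ^ n)%N ->
  rel_trace x = \sum_(i < n) x ^+ (#|k| ^ i).
Proof.
move=> /gal_frobenius [alpha [gg oa] fr].
by rewrite /rel_trace /galTrace gg big_cycle oa; under eq_bigr do rewrite fr.
Qed.

Lemma rel_normE n (x : finvect_type K) :
    #|finvect_type K| = (#|k| ^ n)%N ->
  rel_norm x = \prod_(i < n) x ^+ (#|k| ^ i).
Proof.
move=> /gal_frobenius [alpha [gg oa] fr].
by rewrite /rel_norm /galNorm gg big_cycle oa; under eq_bigr do rewrite fr.
Qed.

End RelTrace.

(** * Unions of cyclotomic classes as preimages under the norm *)

Section CyclotomicPartition.
Variables (s : nat) (E : finFieldType) (F : fieldExtType E) (omega : finvect_type F).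
Notation K := (finvect_type F).
Hypotheses (s_gt0 : (0 < s)%N) (cardE : #|E| = (2 ^ s)%N).
Hypothesis cardK : #|K| = (2 ^ (s * 3))%N.
Notation q := (2 ^ s)%N.
Notation M := (ord_M s).

Lemma char2_K : 2 \in [pchar K].
Proof. exact: card_finPcharP cardK _. Qed.

Lemma card_frob_fixed_K : #|frob_fixed K s| = (2 ^ s)%N.
Proof. by rewrite -[in RHS]cardE -(@card_frob_fixed_sub E K (in_alg K)) cardE. Qed.

Lemma rel_trace_conj_trace (x : K) : rel_trace x = conj_trace s x.
Proof.
rewrite (@rel_traceE _ _ 3) ?cardE ?cardK ?expnM // !big_ord_recr big_ord0 /=.
by rewrite add0r expn0 expr1 expn1 expnS expn1 exprM.
Qed.

Lemma S_conic_line a : S_ s omega a = conic_line s (omega ^+ a).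
Proof. by apply/setP => u; rewrite !inE !rel_trace_conj_trace. Qed.

Lemma ord_ME : M = (q ^ 2 + q + 1)%N.
Proof.
have q1_gt0 : (0 < q - 1)%N by rewrite subn_gt0 -(expn0 2) ltn_exp2l.
rewrite /ord_M mulnC expnM; have -> : (q ^ 3 - 1 = (q ^ 2 + q + 1) * (q - 1))%N; last exact: mulnK.
by case: q q1_gt0 => // n _; rewrite !subn1 /= !expnS expn0; lia.
Qed.

Lemma ord_M_gt1 : (1 < M)%N.
Proof. by rewrite ord_ME addn1 ltnS addn_gt0 !expn_gt0. Qed.

Hypothesis omega_neq0 : omega != 0.

(** omega^M has order dividing q - 1, as M (q - 1) is the order of the multiplicative
    group of K. *)
Lemma omega_ord_M : omega ^+ M \in frob_fixed K s.
Proof.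
rewrite inE; apply/eqP/(mulfI omega_neq0); rewrite -exprM -!exprS.
(* Since M q + 1 = M + q^3, and omega^(q^3) = omega. *)
have -> : (M * q).+1 = (M + q ^ 3)%N by rewrite ord_ME !expnS expn0; lia.
by rewrite exprD exprSr -expnM -cardK expf_card.
Qed.

(** Lines are unchanged by factors in E, and omega^M is one of them. *)
Lemma conic_line_omega_mod k : conic_line s (omega ^+ k) = conic_line s (omega ^+ (k %% M)).
Proof.
rewrite {1}(divn_eq k M) exprD mulnC exprM; apply: conic_lineZ; last by rewrite !expf_neq0.
elim: (k %/ M)%N => [|j IH]; first by rewrite inE expr0 expr1n.
by rewrite exprS frob_fixedM // omega_ord_M.
Qed.

Variables (L : finFieldType) (g : {unit L}) (N : L -> K).
Hypotheses (g_prim : primitive_element g).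
Hypotheses (NM : {morph N : x y / x * y}) (N_eq0 : forall x, (N x == 0) = (x == 0)).
Hypothesis Ng : N (val g) = omega.

Lemma N_pow k : N (val g ^+ k) = omega ^+ k.
Proof.
elim: k => [|k IH]; last by rewrite !exprS NM IH Ng.
have N1 : N 1 != 0 by rewrite N_eq0 oner_neq0.
by apply: (mulfI N1); rewrite -NM !expr0 !mulr1.
Qed.

(** An element g^k lies in the class of k modulo M, and its norm omega^k defines the
    same line as omega^(k mod M). *)
Lemma mem_cyclotomic_union (P : nat -> bool) (x : L) :
  (x \in \bigcup_(i in [set a : 'Z_M | P #|S_ s omega a|]) cyclotomic_class g M i)
  = (x != 0) && P #|conic_line s (N x)|.
Proof.
apply/bigcupP/andP => [[i]|[x_neq0 Px]].
  rewrite inE S_conic_line => Pi /imsetP[u /lcosetP[_ /cycleP[j ->] ->] ->].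
  rewrite -expgM -expgD /= FinRing.val_unitX expf_neq0 -?unitfE ?(valP g) //; split=> //.
  rewrite N_pow conic_line_omega_mod -modnDmr modnMr addn0.
  by rewrite -conic_line_omega_mod.
have [k gk] : exists k, finField_unit x_neq0 = (g ^+ k)%g.
  by apply/cycleP; rewrite -(eqP g_prim) inE.
have xk : x = val g ^+ k by rewrite -FinRing.val_unitX -gk.
(* This residue is k mod M, because M > 1. *)
exists (k%:R : 'Z_M).
  by rewrite inE S_conic_line val_Zp_nat ?ord_M_gt1 // -conic_line_omega_mod -N_pow -xk.
apply/imsetP; exists (g ^+ k)%g; last by rewrite FinRing.val_unitX.
rewrite val_Zp_nat ?ord_M_gt1 // {1}(divn_eq k M) addnC expgD mem_lcoset mulKg.
by rewrite mulnC expgM mem_cycle.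
Qed.

Lemma cyclotomic_partitionE i (x : L) :
  (x \in cyclotomic_partition s omega g i) = (line_class s (N x) == i).
Proof.
have T3E : T3 s omega = [set a : 'Z_M | (#|S_ s omega a| != q - 1)%N &&
                              (#|S_ s omega a| != 2 * (q - 1))%N].
  by apply/setP => a; rewrite !inE negb_or.
have q1_gt0 : (0 < q - 1)%N by rewrite subn_gt0 -(expn0 2) ltn_exp2l.
have neq2 : (q - 1 == 2 * (q - 1))%N = false by clear -q1_gt0; lia.
rewrite /cyclotomic_partition (tnth_nth set0) /line_class N_eq0.
case: i => [[|[|[|[|//]]]] lti] /=.
- rewrite inE; case: (x =P 0) => // _.
  by case: (_ == (q - 1)%N) => //; case: (_ == (2 * (q - 1))%N).
- rewrite (mem_cyclotomic_union (fun n => n == q - 1)%N); case: (x =P 0) => //= _.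
  by case: (_ == (q - 1)%N) => //; case: (_ == (2 * (q - 1))%N).
- rewrite (mem_cyclotomic_union (fun n => n == 2 * (q - 1))%N); case: (x =P 0) => //= _.
  by case: (_ =P (q - 1)%N) => [->|_]; rewrite ?neq2 //; case: (_ == (2 * (q - 1))%N).
rewrite T3E (mem_cyclotomic_union (fun n => (n != q - 1) && (n != 2 * (q - 1)))%N).
case: (x =P 0) => //= _.
by case: (_ == (q - 1)%N) => //; case: (_ == (2 * (q - 1))%N).
Qed.

End CyclotomicPartition.

Theorem theorem7 (s : nat) (s_gt0 : (0 < s)%N)
    (E : finFieldType) (F : fieldExtType E)
    (G H : fieldExtType (finvect_type F))
    (cardE : #|E| = (2 ^ s)%N)
    (cardF : #|finvect_type F| = (2 ^ (3 * s))%N)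
    (cardG : #|finvect_type G| = (2 ^ (6 * s))%N)
    (cardH : #|finvect_type H| = (2 ^ (9 * s))%N)
    (beta : {unit finvect_type H}) (gamma : {unit finvect_type G})
    (omega : finvect_type F)
    (beta_prim : primitive_element beta)
    (gamma_prim : primitive_element gamma)
    (norm_beta : rel_norm (val beta) = omega%:A)
    (norm_gamma : rel_norm (val gamma) = omega%:A) :
  let q : rat := (2 ^ s)%:R in
  let R' := translation_rel (cyclotomic_partition s omega gamma) in
  let R'' := translation_rel (cyclotomic_partition s omega beta) in
  [/\ association_scheme R',
      intersection_matrix R' 1 (BG1 q),
      intersection_matrix R' 2 (BG2 q) &
      intersection_matrix R' 3 (BG3 q)]
  /\
  [/\ association_scheme R'',
      intersection_matrix R'' 1 (BH1 q),
      intersection_matrix R'' 2 (BH2 q) &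
      intersection_matrix R'' 3 (BH3 q)].
Proof.
have cardF' : #|finvect_type F| = (2 ^ (s * 3))%N by rewrite cardF mulnC.
have cardG' : #|finvect_type G| = (2 ^ (s * 3 * 2))%N.
  by rewrite cardG -mulnA mulnC.
have cardH' : #|finvect_type H| = (2 ^ (s * 3 * 3))%N.
  by rewrite cardH -mulnA mulnC.
pose iota2 : {rmorphism finvect_type F -> finvect_type G} := in_alg (finvect_type G).
pose iota3 : {rmorphism finvect_type F -> finvect_type H} := in_alg (finvect_type H).
have char2 := char2_K cardF'; have cardE' := card_frob_fixed_K F cardE.
have nm_gamma : nm2 iota2 (s * 3) (val gamma) = omega.
  apply: (fmorph_inj iota2); rewrite (nm2E iota2 cardF' cardG') /= -[RHS]norm_gamma.
  rewrite (@rel_normE _ _ 2) ?cardF' ?cardG' -?expnM //.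
  by rewrite !big_ord_recr big_ord0 /= mul1r expr1 expn1.
have nm_beta : nm3 iota3 (s * 3) (val beta) = omega.
  apply: (fmorph_inj iota3); rewrite (nm3E iota3 cardF' cardH') /= -[RHS]norm_beta.
  rewrite (@rel_normE _ _ 3) ?cardF' ?cardH' -?expnM //.
  by rewrite !big_ord_recr big_ord0 /= mul1r expr1 expn1 -exprM mulnn.
have omega_neq0 : omega != 0.
  by rewrite -nm_gamma (nm2_eq0 iota2 cardF' cardG') -unitfE (valP gamma).
move=> q R' R''; split.
- have DE := cyclotomic_partitionE s_gt0 cardE cardF' omega_neq0 gamma_prim
    (nm2M iota2 cardF' cardG') (nm2_eq0 iota2 cardF' cardG') nm_gamma.
  have [scheme inter] := quadratic_extension_scheme s_gt0 char2 cardF' cardG' cardE' DE.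
  by split; [exact: scheme | exact: (inter 1) | exact: (inter 2) | exact: (inter 3)].
have DE := cyclotomic_partitionE s_gt0 cardE cardF' omega_neq0 beta_prim
  (nm3M iota3 cardF' cardH') (nm3_eq0 iota3 cardF' cardH') nm_beta.
have [scheme inter] :=
  cubic_extension_scheme iota2 s_gt0 char2 cardF' cardG' cardH' cardE' DE.
by split; [exact: scheme | exact: (inter 1) | exact: (inter 2) | exact: (inter 3)].
Qed.
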